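(* Let $1<p\leq\infty$ and let $\upsilon=\{\upsilon_n\}_{n\in\mathbb{Z}}\in\ell^{p}(\mathbb{Z})$ be a complex sequence. Let $H_V=H_0+V$ be the associated discrete Schrödinger operator on $\ell^2(\mathbb{Z})$. Then $$\sigma(H_V)\subset\Big\{\lambda\in\mathbb{C}\ \Big|\ |\lambda^2-4|\,\operatorname{dist}(\lambda,[-2,2])^{2p-2}\leq\|\upsilon\|_{\ell^p(\mathbb{Z})}^{2p}\Big\},$$ where for $p=\infty$ the inequality defining the set on the right-hand side is understood as $\operatorname{dist}(\lambda,[-2,2])\leq\|\upsilon\|_{\ell^\infty(\mathbb{Z})}$.
   Context: $\{e_n\}_{n\in\mathbb{Z}}$ is the standard basis of the complex Hilbert space $\ell^2(\mathbb{Z})$. The discrete Laplacian $H_0$ is the bounded operator on $\ell^2(\mathbb{Z})$ determined by $H_0e_n=e_{n-1}+e_{n+1}$ for all $n\in\mathbb{Z}$. For a bounded complex sequence $\upsilon=\{\upsilon_n\}_{n\in\mathbb{Z}}$, the potential $V$ is the diagonal operator $Ve_n=\upsilon_ne_n$, $n\in\mathbb{Z}$, and $H_V:=H_0+V$. $\sigma(H_V)$ denotes the spectrum of the bounded operator $H_V$. $\operatorname{dist}(\lambda,[-2,2])$ is the Euclidean distance in $\mathbb{C}$ from $\lambda$ to the real interval $[-2,2]$. *)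

(* Defs.v *)
From HB Require Import structures.
From mathcomp Require Import all_boot all_order all_algebra.
From mathcomp Require Import all_classical all_reals all_analysis.
From mathcomp Require Import finmap ring complex ess_sup_inf.

Set Implicit Arguments.
Unset Strict Implicit.
Unset Printing Implicit Defensive.

Import Order.TTheory GRing.Theory Num.Theory.
Import numFieldNormedType.Exports.

Local Open Scope classical_set_scope.
Local Open Scope ring_scope.


(** [int] carries the discrete sigma-algebra, as [nat] does in the library. *)
HB.instance Definition _ := isPointed.Build int 0.
HB.instance Definition _ := @isMeasurable.Build default_measure_display
  int discrete_measurable discrete_measurable0
  discrete_measurableC discrete_measurableU.

(** [`|z|] lives in [R[i]]; [modulus z] is the same number as an element of
    [R]. *)
Definition modulus (R : realType) (z : R[i]) : R := ComplexField.Normc.normc z.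

Section lp_spaces.
Context (R : realType).
Implicit Types (u v : int -> R[i]) (p : \bar R).
Local Open Scope ereal_scope.

(** The counting measure has no null sets but [set0], so that for [p = +oo] the
    essential supremum underlying [Lnorm] is the supremum of [|u n|]. *)
Definition lpnorm p u : \bar R :=
  Lnorm (@counting int R) p (fun n => (modulus (u n))%:E).

Definition lp p : set (int -> R[i]) := [set u | (lpnorm p u < +oo)%E].

Lemma modulusE (z : R[i]) : `|z|%R = (modulus z)%:C%C.
Proof. by rewrite normc_def; case: z. Qed.

Lemma modulus_ge0 (z : R[i]) : (0 <= modulus z)%R.
Proof. by case: z => a b; rewrite /modulus /= sqrtr_ge0. Qed.

Lemma modulus0 : modulus (0%R : R[i]) = 0%R.
Proof. exact: ComplexField.Normc.normc0. Qed.

Lemma modulus1 : modulus (1%R : R[i]) = 1%R.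
Proof. exact: ComplexField.Normc.normc1. Qed.

Lemma modulusM (z w : R[i]) : modulus (z * w)%R = (modulus z * modulus w)%R.
Proof. exact: ComplexField.Normc.normcM. Qed.

Lemma modulusD (z w : R[i]) : (modulus (z + w)%R <= modulus z + modulus w)%R.
Proof. exact: le_normcD. Qed.

Lemma modulus_eq0 (z : R[i]) : modulus z = 0%R -> z = 0%R.
Proof. exact: ComplexField.Normc.eq0_normc. Qed.

Lemma measurable_int d (T : measurableType d) (f : int -> T) :
  measurable_fun setT f.
Proof. by []. Qed.

Lemma measurable_int_set (A : set int) : measurable A.
Proof. by []. Qed.

Lemma lpnorm_ge0 p u : 0 <= lpnorm p u.
Proof. exact: Lnorm_ge0. Qed.

Lemma lpnormE (r : R) u :
  lpnorm r%:E u =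
  (\int[@counting int R]_n (modulus (u n) `^ r)%:E) `^ r^-1.
Proof.
rewrite /lpnorm unlock; congr (_ `^ _); apply: eq_integral => n _.
by rewrite /= ger0_norm ?modulus_ge0.
Qed.

Lemma counting_set1 (n : int) : @counting int R [set n] = 1.
Proof.
by rewrite /counting asboolT; [rewrite fset_set1 cardfs1|exact: finite_set1].
Qed.

Lemma ae_counting (P : int -> Prop) :
  (\forall n \ae @counting int R, P n) -> forall n, P n.
Proof.
move=> [A [_ A0 PA]] n; apply: contrapT => nPn.
have An : A n by exact: PA.
suff : @counting int R [set n] <= @counting int R A.
  by rewrite counting_set1 A0 leNgt lte01.
by apply: le_measure => [||_ ->//]; apply/mem_set/measurable_int_set.
Qed.

Lemma counting_setT_gt0 : 0 < @counting int R setT.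
Proof.
apply: lt_le_trans (_ : @counting int R [set 0%R] <= _).
  by rewrite counting_set1 lte01.
by apply: le_measure => //; apply/mem_set/measurable_int_set.
Qed.

Lemma lpnormy_leP u (c : \bar R) :
  lpnorm +oo u <= c <-> forall n, (modulus (u n))%:E <= c.
Proof.
rewrite /lpnorm unlock counting_setT_gt0.
have absE n : (abse \o (fun k => (modulus (u k))%:E)) n = (modulus (u n))%:E.
  by rewrite /= ger0_norm ?modulus_ge0.
split=> [/ess_supP/ae_counting h n|h]; first by rewrite -absE; exact: h.
by apply/ess_supP/nearW => n; rewrite absE.
Qed.

Lemma le_lpnorm (r : R) u v : (0 <= r)%R ->
  (forall n, modulus (u n) <= modulus (v n))%R ->
  lpnorm r%:E u <= lpnorm r%:E v.
Proof.
move=> r0 uv; rewrite !lpnormE.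
have int_ge0 (w : int -> R[i]) :
    (\int[@counting int R]_n (modulus (w n) `^ r)%:E) \in `[0, +oo]%E.
  by rewrite in_itv/= leey andbT; apply: integral_ge0 => n _;
     rewrite lee_fin powR_ge0.
apply: gt0_ler_poweR; rewrite ?invr_ge0 //.
apply: ge0_le_integral => //= n _; rewrite lee_fin ?powR_ge0 //.
by rewrite ge0_ler_powR ?nnegrE ?modulus_ge0.
Qed.

Lemma lpnormD (r : R) u v : (1 <= r)%R ->
  lpnorm r%:E (u \+ v)%R <= lpnorm r%:E u + lpnorm r%:E v.
Proof.
move=> r1.
have /= := @minkowski_EFin _ _ _ (@counting int R) (@modulus R \o u)
  (@modulus R \o v) r (@measurable_int _ _ _) (@measurable_int _ _ _) r1.
apply: le_trans.
have -> : Lnorm (@counting int R) r%:E (EFin \o ((@modulus R \o u) \+ (@modulus R \o v))%R)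
  = lpnorm r%:E (fun n => ((modulus (u n) + modulus (v n))%R)%:C%C).
  apply: eq_Lnorm => n /=; congr EFin.
  by rewrite /modulus /= expr0n /= addr0 sqrtr_sqr ger0_norm // addr_ge0 // modulus_ge0.
apply: le_lpnorm => [|n]; first exact: le_trans r1.
rewrite [leRHS]/modulus /= expr0n /= addr0 sqrtr_sqr ger0_norm ?addr_ge0 ?modulus_ge0 //.
exact: modulusD.
Qed.

Lemma lpnormZ (r : R) (a : R[i]) u : (0 < r)%R ->
  lpnorm r%:E (fun n => a * u n)%R = (modulus a)%:E * lpnorm r%:E u.
Proof.
move=> r0; rewrite !lpnormE.
under eq_integral do rewrite modulusM powRM ?modulus_ge0 // EFinM.
rewrite ge0_integralZl ?lee_fin ?powR_ge0 //; last first.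
  by move=> n _; rewrite lee_fin powR_ge0.
rewrite poweRM ?lee_fin ?powR_ge0 //; last first.
  by apply: integral_ge0 => n _; rewrite lee_fin powR_ge0.
by rewrite poweR_EFin -powRrM mulfV ?gt_eqF // powRr1 ?modulus_ge0.
Qed.

Lemma lpnorm_shift (r : R) (k : int) u :
  lpnorm r%:E (fun n => u (n + k)%R) = lpnorm r%:E u.
Proof.
rewrite !lpnormE; congr (_ `^ _).
pose sh (n : int) := (n + k)%R.
have msh : measurable_fun setT sh by exact: measurable_int.
transitivity (\int[pushforward (@counting int R) sh]_n (modulus (u n) `^ r)%:E).
  rewrite (ge0_integral_pushforward msh) //.
  by move=> n _; rewrite lee_fin powR_ge0.
apply: eq_measure_integral => A _ _.
have shA : sh @^-1` A = (fun n => n - k)%R @` A.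
  apply/seteqP; split=> [n An|_ [m Am <-]]; last by rewrite /= /sh subrK.
  by exists (sh n) => //; rewrite /sh addrK.
change (@counting int R (sh @^-1` A) = @counting int R A).
rewrite shA /counting.
have inj : {in A &, injective (fun n : int => n - k)%R} by move=> ? ? _ _ /addIr.
have cA : ((fun n => n - k)%R @` A #= A)%card by exact: inj_card_eq.
have -> : `[< finite_set ((fun n => n - k)%R @` A) >] = `[< finite_set A >].
  by congr asbool; apply/propext; rewrite (eq_finite_set cA).
case: asboolP => // fA; congr (_%:R%:E).
have [m Am] := fA; rewrite (card_fset_set Am).
by apply: card_fset_set; exact: card_eq_trans Am.
Qed.

Lemma lpnorm_basis (r : R) (k : int) : (0 < r)%R ->
  lpnorm r%:E (fun n => (n == k)%:R : R[i]) = 1.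
Proof.
move=> r0; rewrite lpnormE.
rewrite (_ : \int[_]_n _ = 1) ?poweR_EFin ?powR1 //.
rewrite -(counting_set1 k) -(setIT [set k]) -integral_indic //.
apply: eq_integral => n _; rewrite indicE; congr EFin.
case: eqVneq => [->|nk]; first by rewrite modulus1 powR1 mem_set.
by rewrite modulus0 powR0 ?gt_eqF // memNset //; exact/eqP.
Qed.

Lemma lp_bounded p u : 1 <= p -> lp p u -> lp +oo u.
Proof.
case: p => [r||//] //= r1 up.
apply: le_lt_trans up.
apply/lpnormy_leP => n; rewrite lee_fin in r1.
have r0 : (0 < r)%R by exact: lt_le_trans r1.
rewrite -[leLHS]mule1 -(lpnorm_basis n r0) -lpnormZ //.
apply: le_lpnorm => [|m]; first exact: ltW.
rewrite modulusM; case: eqVneq => [->|_]; rewrite ?modulus1 ?modulus0 ?mulr1 //.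
by rewrite mulr0 modulus_ge0.
Qed.

End lp_spaces.

Section ell2_type.
Context (R : realType).
Implicit Types u v : int -> R[i].

Definition ell2_pred : {pred int -> R[i]} := fun u => u \in @lp R 2%:E.

Lemma ell2_predP u : reflect (lp 2%:E u) (u \in ell2_pred).
Proof. by apply: (iffP idP) => [/set_mem|/mem_set]. Qed.

Record ell2 := Ell2 { ell2_val :> int -> R[i]; _ : ell2_val \in ell2_pred }.

HB.instance Definition _ := [isSub for ell2_val].
HB.instance Definition _ := [Choice of ell2 by <:].

Lemma ell2_submod_closed : submod_closed ell2_pred.
Proof.
split=> [|a u v /ell2_predP ul /ell2_predP vl]; apply/ell2_predP.
  rewrite /lp /= (_ : lpnorm _ _ = 0%E) ?ltry //.
  have := @lpnormZ R 2 0 0 (ltr0Sn _ _).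
  rewrite modulus0 mul0e => <-; congr lpnorm.
  by apply/funext => n; rewrite mul0r.
apply: le_lt_trans (lpnormD (a *: u) v _) _; first by rewrite ler1n.
rewrite lte_add_pinfty //.
have -> : (a *: u)%R = (fun n => a * u n) by [].
by rewrite lpnormZ ?ltr0n // lte_mul_pinfty ?lee_fin ?modulus_ge0.
Qed.

HB.instance Definition _ :=
  GRing.isSubmodClosed.Build _ _ ell2_pred ell2_submod_closed.
HB.instance Definition _ := [SubChoice_isSubLmodule of ell2 by <:].

Lemma ell2P (x : ell2) : lp 2%:E x.
Proof. by apply/ell2_predP; exact: valP. Qed.

(** A norm on a module over [R[i]] must take its values in [R[i]]. *)
Definition ell2norm (x : ell2) : R[i] := (fine (lpnorm 2%:E x))%:C%C.

Lemma ell2norm_fin (x : ell2) : lpnorm 2%:E x \is a fin_num.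
Proof. by rewrite ge0_fin_numE ?lpnorm_ge0 //; exact: ell2P. Qed.

Lemma ell2normD (x y : ell2) : ell2norm (x + y) <= ell2norm x + ell2norm y.
Proof.
rewrite /ell2norm -rmorphD lecR -lee_fin [leRHS]EFinD !fineK ?ell2norm_fin //.
by apply: (@lpnormD R 2 x y); rewrite ler1n.
Qed.

Lemma ell2normZ (a : R[i]) (x : ell2) : ell2norm (a *: x) = `|a| * ell2norm x.
Proof.
rewrite /ell2norm modulusE -rmorphM; congr (_%:C%C).
apply: EFin_inj; rewrite EFinM !fineK ?ell2norm_fin //.
by rewrite -(@lpnormZ R 2 a x) ?ltr0n.
Qed.

Lemma ell2norm_eq0 (x : ell2) : ell2norm x = 0 -> x = 0.
Proof.
move=> xN0; have x0 : lpnorm 2%:E x = 0%E.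
  by rewrite -[LHS]fineK ?ell2norm_fin //; congr EFin; case: xN0.
apply/val_inj/funext => n; apply: modulus_eq0; apply/le_anti.
rewrite modulus_ge0 andbT -lee_fin.
rewrite -[leRHS]x0 -[leLHS]mule1 -(lpnorm_basis n (ltr0Sn R 1)) -lpnormZ //.
apply: le_lpnorm => // m.
rewrite modulusM; case: eqVneq => [->|_]; rewrite ?modulus1 ?modulus0 ?mulr1 //.
by rewrite mulr0 modulus_ge0.
Qed.

HB.instance Definition _ :=
  Lmodule_isNormed.Build R[i] ell2 ell2normD ell2normZ ell2norm_eq0.
End ell2_type.

Section operators.
Context (R : realType).
Implicit Types (v : int -> R[i]) (x : ell2 R).

Lemma basis_subproof (k : int) :
  (fun n => (n == k)%:R : R[i]) \in @ell2_pred R.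
Proof.
by apply/ell2_predP; rewrite /lp /= lpnorm_basis ?ltr0n // ltry.
Qed.

Definition basis (k : int) : ell2 R := Ell2 (basis_subproof k).

Lemma shift_subproof (k : int) x : (fun n => x (n + k)) \in @ell2_pred R.
Proof. by apply/ell2_predP; rewrite /lp /= lpnorm_shift; exact: ell2P. Qed.

Definition shift (k : int) x : ell2 R := Ell2 (shift_subproof k x).

Definition laplacian x : ell2 R := shift (- 1) x + shift 1 x.

(** For bounded [v] the sequence [fun n => v n * x n] is in [ell2], and the
    default value [0] of [insubd] is never reached: see [potentialE]. *)
Definition potential v x : ell2 R := insubd 0 (fun n => v n * x n).

Definition schrodinger v : ell2 R -> ell2 R := laplacian \+ potential v.

Lemma laplacianE x n : laplacian x n = x (n - 1) + x (n + 1).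
Proof. by []. Qed.

Lemma potential_bound v x :
  lp +oo%E v ->
  (lpnorm 2%:E (fun n => v n * x n)%R <= lpnorm +oo v * lpnorm 2%:E x)%E.
Proof.
move=> vb; have vfin : lpnorm +oo v \is a fin_num.
  by rewrite ge0_fin_numE ?lpnorm_ge0.
have v0 : 0 <= fine (lpnorm +oo v) by rewrite fine_ge0 ?lpnorm_ge0.
pose c : R[i] := (fine (lpnorm +oo v))%:C%C.
have cE : modulus c = fine (lpnorm +oo v).
  by rewrite /modulus /= expr0n /= addr0 sqrtr_sqr ger0_norm.
rewrite -[in leRHS](fineK vfin) -cE -lpnormZ ?ltr0n //.
apply: le_lpnorm => // n; rewrite !modulusM ler_wpM2r ?modulus_ge0 //.
by rewrite cE -lee_fin fineK //; exact: (lpnormy_leP v _).1 (lexx _) n.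
Qed.

Lemma potentialE v x n : lp +oo%E v -> potential v x n = v n * x n.
Proof.
move=> vb; rewrite /potential -[LHS]/(val _ n) val_insubd ifT //; apply/ell2_predP.
apply: le_lt_trans (potential_bound x vb) _.
by rewrite lte_mul_pinfty ?ge0_fin_numE ?lpnorm_ge0 //; exact: ell2P.
Qed.

Lemma laplacian_basis k : laplacian (basis k) = basis (k - 1) + basis (k + 1).
Proof.
apply/val_inj/funext => n.
rewrite -[LHS]/(laplacian (basis k) n) laplacianE.
rewrite -[RHS]/(basis (k - 1) n + basis (k + 1) n) /=.
have -> : (n - 1 == k) = (n == k + 1) by rewrite subr_eq.
have -> : (n + 1 == k) = (n == k - 1) by rewrite [RHS]eq_sym subr_eq eq_sym.
by rewrite addrC.
Qed.

Lemma potential_basis v k : lp +oo%E v ->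
  potential v (basis k) = v k *: basis k.
Proof.
move=> vb; apply/val_inj/funext => n.
rewrite -[LHS]/(potential v (basis k) n) potentialE //.
rewrite -[RHS]/(v k * basis k n) /=.
by case: eqVneq => [->|]; rewrite ?mulr0.
Qed.

Lemma schrodingerE v x n : lp +oo%E v ->
  schrodinger v x n = x (n - 1) + x (n + 1) + v n * x n.
Proof.
move=> vb; transitivity (laplacian x n + potential v x n) => //.
by rewrite laplacianE potentialE.
Qed.

Lemma schrodinger_linear v : lp +oo%E v -> linear (schrodinger v).
Proof.
move=> vb a x y; apply/val_inj/funext => n.
have A (z w : ell2 R) m : (a *: z + w) m = a * z m + w m by [].
transitivity (schrodinger v (a *: x + y) n) => //.
transitivity (a * schrodinger v x n + schrodinger v y n) => //.
rewrite (schrodingerE (a *: x + y) n vb) (schrodingerE x n vb).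
rewrite (schrodingerE y n vb) !A; ring.
Qed.

Lemma schrodinger_bound v : lp +oo%E v -> exists M : R,
  forall x, `|schrodinger v x| <= M%:C%C * `|x|.
Proof.
move=> vb; exists (2 + fine (lpnorm +oo v)) => x.
have vfin : lpnorm +oo v \is a fin_num.
  by rewrite ge0_fin_numE ?lpnorm_ge0.
have nE (z : ell2 R) : `|z| = ell2norm z by [].
have nS k : `|shift k x| = `|x|.
  by rewrite !nE /ell2norm [in LHS]lpnorm_shift.
have nV : `|potential v x| <= (fine (lpnorm +oo v))%:C%C * `|x|.
  rewrite !nE /ell2norm -rmorphM lecR -lee_fin [leRHS]EFinM.
  rewrite !fineK ?ell2norm_fin //.
  apply: le_trans (potential_bound x vb).
  by rewrite le_eqVlt; apply/orP; left; apply/eqP; congr lpnorm;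
     apply/funext => n; rewrite potentialE.
rewrite rmorphD rmorph_nat mulrDl; apply: le_trans (ler_normD _ _) _; apply: lerD nV.
by rewrite mulr_natl mulr2n (le_trans (ler_normD _ _)) // !nS.
Qed.

Lemma schrodinger_continuous v : lp +oo%E v -> continuous (schrodinger v).
Proof.
move=> vb; have [M SM] := schrodinger_bound vb.
pose L := GRing.isLinear.Build _ _ _ _ _ (schrodinger_linear vb).
pose S : {linear ell2 R -> ell2 R} := HB.pack (schrodinger v) L.
apply: (@bounded_linear_continuous _ _ _ S).
apply/linear_boundedP; exists M%:C%C; split; first by rewrite complex_real.
by move=> r Mr x; apply: le_trans (SM x) _; rewrite ler_wpM2r // ltW.
Qed.

End operators.

Section spectrum.
Context (K : numFieldType) (V : normedModType K).

(** Meant for a bounded linear operator [T]; the values [l] in the resolvent set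
    are those for which [T - l] has an inverse among such operators. *)
Definition resolvent_set (T : V -> V) : set K :=
  [set l | exists S : {linear V -> V},
     [/\ continuous S, cancel (fun x => T x - l *: x) S &
         cancel S (fun x => T x - l *: x)]].

Definition spectrum (T : V -> V) : set K := ~` resolvent_set T.

End spectrum.

Section distance.
Context (R : realType).

Definition dist (z : R[i]) (A : set R[i]) : R :=
  inf [set modulus (z - a) | a in A].

Definition segment : set R[i] := [set x%:C%C | x in `[- 2, 2]].

End distance.

(* Main.v *)
(** Write [l = k + k^-1] with [|k| < 1], so that the Laplacian minus [l] has the
    Green kernel [k^|m-n| / (k - k^-1)]. Its entries are bounded by
    [|l^2 - 4|^(-1/2)] and its norm on l^2 is at most [1 / dist(l, [-2,2])].
    With [W = |v|^(1/2)], a Heinz-type inequality, i.e. log-convexity of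
    [s |-> ||P^s G P^s||] for [P = |v|^(p/2)], interpolates between these two
    bounds and gives [||W G W|| < 1] outside the enclosure. By the
    Birman-Schwinger principle the equation [(H_V - l) x = f] can then be solved,
    with uniform bounds, on finite windows; a pointwise limit along an ultrafilter
    solves the full equation, and the discrete Wronskian against the solution for
    a basis vector shows that the solution is unique. *)

Require Import Defs.
From HB Require Import structures.
From mathcomp Require Import all_boot all_order all_algebra.
From mathcomp Require Import all_classical all_reals all_analysis.
From mathcomp Require Import complex ring lra zify.

Set Implicit Arguments.
Unset Strict Implicit.
Unset Printing Implicit Defensive.

Import Order.TTheory GRing.Theory Num.Theory.
Import numFieldNormedType.Exports.

Local Open Scope classical_set_scope.
Local Open Scope ring_scope.

(** * Finite-dimensional vectors and operator bounds *)

(** The exponents of the enclosure come from the two ends of the interpolation. For finite [p = r],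
    let d be the distance of l to the segment and g = |k - k^-1|, so that g^2 = |l^2 - 4|. At s = 0
    the norm is at most 1/d; at s = 1 the Hilbert-Schmidt bound is ||v||_r^r / g. The weight W is
    reached at s = 1/r, where the interpolated bound d^(-(1 - 1/r)) (||v||_r^r / g)^(1/r) is below 1
    exactly when ||v||_r^r < g d^(r-1). Squaring this describes the complement of the enclosure.
    Working with finite matrices keeps adjoints, powers and inverses elementary, but a truncated
    Green matrix does not invert the truncated Laplacian. The full kernel is therefore applied to a
    source living on the window: the free equation then holds on all of Z, the perturbed one on the
    window, and no constant depends on the window. For complex [v] the operator is not self-adjoint,
    so injectivity cannot be read off from surjectivity by taking adjoints. The recurrence is
    however symmetric without conjugation, which is what the Wronskian exploits. *)

Section vectors.
Context (R : realType) (n : nat).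
Local Notation C := R[i].
Implicit Types (x y z : 'cV[C]_n) (B E : 'M[C]_n).

(** Lagrange's identity: the double sum of the squares [(a i * b j - a j * b i) ^+ 2] is twice the
    gap between the two sides. *)
Lemma sum_cauchy_schwarz (I : finType) (a b : I -> R) :
  (\sum_i a i * b i) ^+ 2 <= (\sum_i a i ^+ 2) * (\sum_i b i ^+ 2).
Proof.
have H : 0 <= \sum_i \sum_j (a i * b j - a j * b i) ^+ 2.
  by apply: sumr_ge0 => i _; apply: sumr_ge0 => j _; exact: sqr_ge0.
have E : \sum_i \sum_j (a i * b j - a j * b i) ^+ 2 =
    2 * ((\sum_i a i ^+ 2) * (\sum_i b i ^+ 2) - (\sum_i a i * b i) ^+ 2).
  transitivity (\sum_i \sum_j (a i ^+ 2 * b j ^+ 2) +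
      \sum_i \sum_j (b i ^+ 2 * a j ^+ 2) -
      2 * (\sum_i \sum_j (a i * b i) * (a j * b j))).
    rewrite mulr_sumr -big_split -sumrB /=; apply: eq_bigr => i _.
    rewrite mulr_sumr -big_split -sumrB /=; apply: eq_bigr => j _; ring.
  have D (f g : I -> R) : \sum_i \sum_j f i * g j = (\sum_i f i) * (\sum_i g i).
    by rewrite mulr_suml; apply: eq_bigr => i _; rewrite mulr_sumr.
  rewrite !D; ring.
by move: H; rewrite E pmulr_rge0 // subr_ge0.
Qed.

Definition vnorm x : R := Num.sqrt (\sum_i modulus (x i 0) ^+ 2).

Definition ip x y : C := \sum_i x i 0 * conjc (y i 0).

Definition adj B : 'M[C]_n := (map_mx conjc B)^T.

Definition opb B (c : R) := forall x, vnorm (B *m x) <= c * vnorm x.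

Lemma vnorm_ge0 x : 0 <= vnorm x. Proof. exact: sqrtr_ge0. Qed.

Lemma sqr_vnorm x : vnorm x ^+ 2 = \sum_i modulus (x i 0) ^+ 2.
Proof. by rewrite sqr_sqrtr // sumr_ge0 // => i _; exact: sqr_ge0. Qed.

Lemma vnorm_eq0 x : vnorm x = 0 -> x = 0.
Proof.
move=> x0; have /eqP := sqr_vnorm x; rewrite x0 expr0n /= eq_sym.
rewrite psumr_eq0 => [|i _]; last exact: sqr_ge0.
move=> /allP h; apply/matrixP => i j; rewrite (ord1 j) mxE.
by apply: modulus_eq0; have := h i (mem_index_enum i); rewrite sqrf_eq0 => /eqP.
Qed.

Lemma modulus_sum (I : finType) (F : I -> C) :
  modulus (\sum_i F i) <= \sum_i modulus (F i).
Proof.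
elim/big_ind2: _ => [|a b c d h1 h2|//]; first by rewrite modulus0.
by apply: le_trans (modulusD _ _) _; exact: lerD.
Qed.

Lemma modulusJ (z : C) : modulus (conjc z) = modulus z.
Proof. by case: z => a b; rewrite /modulus /= sqrrN. Qed.

Lemma modulusN (z : C) : modulus (- z) = modulus z.
Proof. exact: normcN. Qed.

Lemma modulus_real (a : R) : modulus a%:C%C = `|a|.
Proof. by rewrite /modulus /= expr0n addr0 sqrtr_sqr. Qed.

Lemma sqr_modulus (z : C) : modulus z ^+ 2 = complex.Re z ^+ 2 + complex.Im z ^+ 2.
Proof. by case: z => a b; rewrite /modulus /= sqr_sqrtr // addr_ge0 // sqr_ge0. Qed.

Lemma Im_le_modulus (z : C) : `|complex.Im z| <= modulus z.
Proof.
rewrite -ler_sqr ?nnegrE ?modulus_ge0 //.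
by rewrite sqr_modulus real_normK ?num_real // lerDr sqr_ge0.
Qed.

Lemma normRe_le_modulus (z : C) : `|complex.Re z| <= modulus z.
Proof.
rewrite -ler_sqr ?nnegrE ?modulus_ge0 //.
by rewrite sqr_modulus real_normK ?num_real // lerDl sqr_ge0.
Qed.

Lemma Re_le_modulus (z : C) : complex.Re z <= modulus z.
Proof. exact: le_trans (ler_norm _) (normRe_le_modulus z). Qed.

Lemma modulus_ip x y : modulus (ip x y) <= vnorm x * vnorm y.
Proof.
apply: le_trans (modulus_sum _) _.
rewrite -ler_sqr ?nnegrE ?sumr_ge0 ?mulr_ge0 ?vnorm_ge0 //; last first.
  by move=> i _; exact: modulus_ge0.
rewrite exprMn !sqr_vnorm; under eq_bigr do rewrite modulusM modulusJ.
exact: sum_cauchy_schwarz.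
Qed.

Lemma ipxx x : ip x x = (vnorm x ^+ 2)%:C%C.
Proof.
rewrite sqr_vnorm rmorph_sum; apply: eq_bigr => i _.
by rewrite rmorphXn /= -sqr_normc modulusE.
Qed.

Lemma ip_adj B x y : ip (B *m x) y = ip x (adj B *m y).
Proof.
rewrite /ip; transitivity (\sum_i \sum_j B i j * x j 0 * conjc (y i 0)).
  by apply: eq_bigr => i _; rewrite mxE mulr_suml.
rewrite exchange_big; apply: eq_bigr => j _.
rewrite mxE rmorph_sum mulr_sumr; apply: eq_bigr => i _.
by rewrite !mxE rmorphM /= conjcK; ring.
Qed.

Lemma adjK B : adj (adj B) = B.
Proof. by apply/matrixP => i j; rewrite !mxE conjcK. Qed.

Lemma adjM B E : adj (B *m E) = adj E *m adj B.
Proof. by rewrite /adj map_mxM trmx_mul. Qed.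

Lemma vnormD x y : vnorm (x + y) <= vnorm x + vnorm y.
Proof.
rewrite -ler_sqr ?nnegrE ?addr_ge0 ?vnorm_ge0 // sqrrD !sqr_vnorm.
apply: (@le_trans _ _ (\sum_i (modulus (x i 0) + modulus (y i 0)) ^+ 2)).
  apply: ler_sum => i _; rewrite mxE ler_sqr ?nnegrE ?addr_ge0 ?modulus_ge0 //.
  exact: modulusD.
under eq_bigr do rewrite sqrrD; rewrite !big_split /= lerD2r lerD2l.
rewrite -mulr2n lerMn2r /=.
rewrite -ler_sqr ?nnegrE ?sumr_ge0 ?mulr_ge0 ?vnorm_ge0 //; last first.
  by move=> i _; rewrite mulr_ge0 ?modulus_ge0.
by rewrite exprMn !sqr_vnorm; exact: sum_cauchy_schwarz.
Qed.

Lemma vnormN x : vnorm (- x) = vnorm x.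
Proof.
by rewrite /vnorm; congr Num.sqrt; apply: eq_bigr => i _; rewrite mxE modulusN.
Qed.

Lemma opbM B E (b e : R) : 0 <= b -> opb B b -> opb E e -> opb (B *m E) (b * e).
Proof.
move=> b0 hB hE x; rewrite -mulmxA -mulrA.
by apply: le_trans (hB _) _; exact: ler_wpM2l.
Qed.

(** Testing with [y = B *m x] recovers the norm. The form is a finite sum in the entries of [B], so
    a bound in this shape passes to limits, as needed in [sandwich_interpolation]. *)
Lemma opb_ip B (c : R) : 0 <= c ->
  opb B c <-> forall x y, complex.Re (ip (B *m x) y) <= c * vnorm x * vnorm y.
Proof.
move=> c0; split=> [h x y|h x].
  apply: le_trans (Re_le_modulus _) _; apply: le_trans (modulus_ip _ _) _.
  by rewrite ler_wpM2r ?vnorm_ge0.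
have [->|B0] := eqVneq (vnorm (B *m x)) 0.
  by rewrite mulr_ge0 ?vnorm_ge0.
have Bp : 0 < vnorm (B *m x) by rewrite lt_def B0 vnorm_ge0.
by rewrite -(ler_pM2r Bp) -expr2; have := h x (B *m x); rewrite ipxx.
Qed.

Lemma opb_adj B (c : R) : 0 <= c -> opb B c -> opb (adj B) c.
Proof.
move=> c0 hB y.
have [->|B0] := eqVneq (vnorm (adj B *m y)) 0.
  by rewrite mulr_ge0 ?vnorm_ge0.
have Bp : 0 < vnorm (adj B *m y) by rewrite lt_def B0 vnorm_ge0.
rewrite -(ler_pM2r Bp) -expr2 -[leLHS]/(complex.Re (_ ^+ 2)%:C%C) -ipxx -ip_adj.
apply: le_trans (Re_le_modulus _) _; apply: le_trans (modulus_ip _ _) _.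
by rewrite mulrAC ler_wpM2r ?vnorm_ge0.
Qed.

Lemma opb_le B (c d : R) : c <= d -> opb B c -> opb B d.
Proof. by move=> cd h x; apply: le_trans (h x) _; rewrite ler_wpM2r ?vnorm_ge0. Qed.

Lemma diag_mx_col (d : 'rV[C]_n) x i : (diag_mx d *m x) i 0 = d 0 i * x i 0.
Proof. by rewrite mul_diag_mx mxE. Qed.

Lemma opb_diag (d : 'rV[C]_n) (c : R) : 0 <= c ->
  (forall i, modulus (d 0 i) <= c) -> opb (diag_mx d) c.
Proof.
move=> c0 h x.
rewrite -ler_sqr ?nnegrE ?mulr_ge0 ?vnorm_ge0 // exprMn !sqr_vnorm mulr_sumr.
apply: ler_sum => i _; rewrite diag_mx_col modulusM exprMn.
by rewrite ler_wpM2r ?sqr_ge0 // ler_sqr ?nnegrE ?modulus_ge0.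
Qed.

End vectors.

(** Log-convexity keeps the ratios [b k.+1 / b k] from decreasing. If the first one were [q * c]
    with [q > 1], then [b] would grow at least like [(q * c) ^+ k], whereas Bernoulli's inequality
    lets [q ^+ k] outgrow any constant. *)
Lemma logconvex_growth (R : realType) (b : nat -> R) (c K : R) :
  0 < c -> (forall k, 0 <= b k) ->
  (forall k, b k.+1 ^+ 2 <= b k * b k.+2) ->
  (forall k, b k.+1 <= K * c ^+ k) -> b 1%N <= c * b 0%N.
Proof.
move=> c0 b0 bb bK; rewrite leNgt; apply/negP => lt1.
have b0p : 0 < b 0%N.
  rewrite lt_def b0 andbT; apply/eqP => bz; have := bb 0%N.
  by rewrite bz mul0r leNgt exprn_gt0 //; move: lt1; rewrite bz mulr0.
have b1p : 0 < b 1%N by apply: lt_trans lt1; exact: mulr_gt0.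
have step k : 0 < b k /\ b 1%N * b k <= b 0%N * b k.+1.
  elim: k => [|k [bk le]]; first by rewrite mulrC.
  have bk1 : 0 < b k.+1.
    by rewrite -(pmulr_rgt0 _ b0p); apply: lt_le_trans le; exact: mulr_gt0.
  split=> //; rewrite -(ler_pM2r bk); apply: (@le_trans _ _ (b 0%N * b k.+1 ^+ 2)).
    by rewrite mulrAC expr2 mulrA ler_wpM2r // ltW.
  by rewrite -mulrA ler_wpM2l // mulrC.
pose q := b 1%N / b 0%N / c.
have q1 : 1 < q by rewrite /q ltr_pdivlMr // ltr_pdivlMr // mul1r.
have qk k : b 1%N * (q ^+ k * c ^+ k) <= b k.+1.
  elim: k => [|k IH]; first by rewrite !expr0 !mulr1.
  have [_] := step k.+1; rewrite -ler_pdivrMl //; apply: le_trans.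
  rewrite [leRHS](_ : _ = (b 1%N / b 0%N) * b k.+1); last by ring.
  have -> : b 1%N * (q ^+ k.+1 * c ^+ k.+1) =
      b 1%N / b 0%N * (b 1%N * (q ^+ k * c ^+ k)).
    by rewrite !exprS /q; field; rewrite !gt_eqF.
  by rewrite ler_pM2l // divr_gt0.
have qK k : q ^+ k <= K / b 1%N.
  rewrite ler_pdivlMr // mulrC; have ck : 0 < c ^+ k by exact: exprn_gt0.
  by rewrite -(ler_pM2r ck) -mulrA; exact: le_trans (qk k) (bK k).
have bern k : 1 + k%:R * (q - 1) <= q ^+ k.
  elim: k => [|k IH]; first by rewrite mul0r addr0 expr0.
  rewrite exprS; have q0 : 0 <= q by lra.
  apply: le_trans (ler_wpM2l q0 IH); rewrite -natr1.
  have : 0 <= k%:R * (q - 1) ^+ 2 by rewrite mulr_ge0 ?sqr_ge0.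
  by set t := k%:R; lra.
have M0 : 0 <= K / b 1%N / (q - 1).
  apply: divr_ge0; last lra.
  by apply: le_trans (qK 0%N); rewrite expr0.
have := archi_boundP M0; set N := Num.bound _; rewrite ltr_pdivrMr; last lra.
by have := bern N; have := qK N; set t := N%:R * _; lra.
Qed.

Lemma cvg_sum (K : numFieldType) (T : Type) (F : set_system T) (FF : Filter F)
    (I : Type) (r : seq I) (f : I -> T -> K) (l : I -> K) :
  (forall i, f i x @[x --> F] --> l i) ->
  (\sum_(i <- r) f i x) @[x --> F] --> \sum_(i <- r) l i.
Proof.
move=> h; elim: r => [|i r IH].
  by rewrite big_nil; under eq_cvg do rewrite big_nil; exact: cvg_cst.
by rewrite big_cons; under eq_cvg do rewrite big_cons; exact: cvgD.
Qed.

(** The condition [0 < s] avoids the jump at base 0, where the power is 0 for every nonzero exponent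
    but 1 for exponent 0. *)
Lemma cvg_powR_exponent (R : realType) (x s : R) (u : nat -> R) : 0 < s ->
  u @ \oo --> s -> (x `^ u k) @[k --> \oo] --> x `^ s.
Proof.
move=> s0 us; rewrite /powR; have [_|x0] := eqVneq x 0; last first.
  by apply: continuous_cvg; [exact: continuous_expR|exact: cvgMl].
rewrite (gt_eqF s0); apply: cvg_near_cst.
have : \forall k \near \oo, 0 < u k by apply: cvgr_gt us _ s0.
by apply: filterS => k uk; rewrite /= gt_eqF.
Qed.

(** * The Heinz-type inequality *)

Section interpolation.
Context (R : realType) (n : nat).
Local Notation C := R[i].
Implicit Types (x y : 'cV[C]_n) (A B T : 'M[C]_n) (p : 'I_n -> R).

(** Self-adjointness gives ||T^(k+1) x||^2 = <T^k x, T^(k+2) x>, so the norms ||T^k x|| are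
    log-convex in k. The constant [K] thus drops out and only the growth rate counts; this stands in
    for the equality of norm and spectral radius. *)
Lemma selfadjoint_growth T (c K : R) x : adj T = T -> 0 < c ->
  (forall k, vnorm (iter k.+1 (mulmx T) x) <= K * c ^+ k) ->
  vnorm (T *m x) <= c * vnorm x.
Proof.
move=> Tsa c0 h; pose b k := vnorm (iter k (mulmx T) x).
apply: (@logconvex_growth R b c K) => // [k|k]; first exact: vnorm_ge0.
rewrite -[leLHS]/(complex.Re (_ ^+ 2)%:C%C) -ipxx ![iter k.+1 _ _]iterS.
rewrite ip_adj Tsa -!iterS.
by apply: le_trans (Re_le_modulus _) _; exact: modulus_ip.
Qed.

(** As 0^0 = 1 here, exponent 0 gives the identity even where [p] vanishes. *)
Definition dpow p (s : R) : 'M[C]_n := diag_mx (\row_i (p i `^ s)%:C%C).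

Lemma dpow_adj p s : adj (dpow p s) = dpow p s.
Proof.
apply/matrixP => i j; rewrite !mxE eq_sym.
by case: eqVneq => [->|_]; rewrite ?mulr1n ?mulr0n ?conjc_real ?conjc0.
Qed.

Lemma dpowD p s t : 0 < s + t -> dpow p s *m dpow p t = dpow p (s + t).
Proof.
move=> st; rewrite /dpow mulmx_diag; congr diag_mx; apply/rowP => i.
by rewrite !mxE -rmorphM /= -powRD // gt_eqF.
Qed.

Lemma opb_dpow p s : (forall i, 0 <= p i) -> exists2 K, 0 <= K & opb (dpow p s) K.
Proof.
move=> p0; exists (\sum_i p i `^ s); first by apply: sumr_ge0 => i _; exact: powR_ge0.
apply: opb_diag => [|i]; first by apply: sumr_ge0 => i _; exact: powR_ge0.
rewrite mxE modulus_real ger0_norm ?powR_ge0 // (bigD1 i) //= lerDl.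
by apply: sumr_ge0 => j _; exact: powR_ge0.
Qed.

Definition sandwich A p s : 'M[C]_n := dpow p s *m A *m dpow p s.

(** The intertwiner [D] may be singular, so [T = adj B *m B] need not be similar to [Y]. Still
    T^(k+1) x = D Y^k L x, which grows at most like c^k up to a constant that [selfadjoint_growth]
    discards. The square root comes from ||B x||^2 = <x, T x>. *)
Lemma opb_intertwine B (D L Y : 'M[C]_n) (c K : R) : 0 < c -> 0 <= K ->
  opb D K -> opb Y c -> adj B *m B = D *m L -> adj B *m B *m D = D *m Y ->
  opb B (Num.sqrt c).
Proof.
move=> c0 K0 hD hY.
have Tsa : adj (adj B *m B) = adj B *m B by rewrite adjM adjK.
have BT x : vnorm (B *m x) ^+ 2 <= vnorm x * vnorm (adj B *m B *m x).
  rewrite -[leLHS]/(complex.Re (_ ^+ 2)%:C%C) -ipxx ip_adj mulmxA.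
  by apply: le_trans (Re_le_modulus _) _; exact: modulus_ip.
move: (adj B *m B) Tsa BT => T Tsa BT TL TD x.
have Tit y k : iter k (mulmx T) (D *m y) = D *m iter k (mulmx Y) y.
  elim: k => [//|k IH]; rewrite !iterS IH.
  rewrite mulmxA TD; exact: esym (mulmxA _ _ _).
have Yit y k : vnorm (iter k (mulmx Y) y) <= c ^+ k * vnorm y.
  elim: k => [|k IH]; first by rewrite expr0 mul1r.
  rewrite iterS exprS -mulrA; apply: le_trans (hY _) _.
  by rewrite ler_wpM2l // ltW.
have Tx : vnorm (T *m x) <= c * vnorm x.
  apply: (@selfadjoint_growth T c (K * vnorm (L *m x))) => // k.
  have -> : iter k.+1 (mulmx T) x = D *m iter k (mulmx Y) (L *m x).
    by rewrite -Tit iterSr mulmxA -TL.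
  apply: le_trans (hD _) _; rewrite -mulrA [_ * (_ ^+ _)]mulrC.
  by apply: ler_wpM2l => //; exact: Yit.
have s0 : 0 <= Num.sqrt c by exact: sqrtr_ge0.
have x0 := vnorm_ge0 x.
rewrite -ler_sqr ?nnegrE ?vnorm_ge0 ?(mulr_ge0 s0 x0) //.
rewrite exprMn (sqr_sqrtr (ltW c0)).
apply: le_trans (BT x) _.
by rewrite expr2 mulrA mulrC ler_wpM2r.
Qed.

(* With [D_u = dpow p u], [M_u = sandwich A p u] and [m = (s + t) / 2], the
   self-adjoint [T = M_m^* M_m] satisfies [T D_(m-s) = D_(m-s) M_s^* M_t], so
   that the powers of [T] grow at most like [(a b)^k]. *)
Lemma sandwich_midpoint A p (s t a b : R) : (forall i, 0 <= p i) ->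
  0 <= s -> s < t -> 0 < a -> 0 < b ->
  opb (sandwich A p s) a -> opb (sandwich A p t) b ->
  opb (sandwich A p ((s + t) / 2)) (Num.sqrt (a * b)).
Proof.
move=> p0 s0 st a0 b0 Ms Mt.
pose m := (s + t) / 2; pose d := (t - s) / 2.
pose M := sandwich A p m; pose T := adj M *m M.
pose Y := adj (sandwich A p s); pose X := sandwich A p t.
(* [L] is what remains of [T] once its left factor [dpow p m] is split as [dpow p d *m dpow p s]. *)
pose L := dpow p s *m adj A *m dpow p (s + t) *m A *m dpow p m.
have YE : Y = dpow p s *m adj A *m dpow p s.
  by rewrite /Y /sandwich !adjM !dpow_adj mulmxA.
have m0 : 0 < m by rewrite /m; lra.
have mm : m + m = s + t by rewrite /m; field.
have ds : d + s = m by rewrite /m /d; field.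
have md : m + d = t by rewrite /m /d; field.
have Dmm : dpow p m *m dpow p m = dpow p (s + t).
  by rewrite dpowD ?addr_gt0 // mm.
have Dds : dpow p d *m dpow p s = dpow p m by rewrite dpowD ds.
have Dmd : dpow p m *m dpow p d = dpow p t.
  by rewrite dpowD md //; exact: le_lt_trans st.
have Dst : dpow p s *m dpow p t = dpow p (s + t).
  by rewrite dpowD //; lra.
have TE : T = dpow p m *m adj A *m dpow p (s + t) *m A *m dpow p m.
  by rewrite -Dmm /T /M /sandwich !adjM !dpow_adj !mulmxA.
have TL : T = dpow p d *m L by rewrite TE /L !mulmxA Dds.
have TD : T *m dpow p d = dpow p d *m (Y *m X).
  by rewrite TE -mulmxA Dmd -Dst YE /X /sandwich !mulmxA Dds.
have [K K0 hK] := opb_dpow d p0.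
have YX : opb (Y *m X) (a * b).
  by apply: opbM (ltW a0) _ Mt; apply: opb_adj Ms; exact: ltW.
exact: (@opb_intertwine M _ L _ (a * b) K (mulr_gt0 a0 b0) K0 hK YX TL TD).
Qed.

Lemma sandwich_dyadic A p (a b : R) (N k : nat) : (forall i, 0 <= p i) ->
  0 < a -> 0 < b -> opb (sandwich A p 0) a -> opb (sandwich A p 1) b ->
  (k <= 2 ^ N)%N -> let s := k%:R / 2 ^+ N in
  opb (sandwich A p s) (a `^ (1 - s) * b `^ s).
Proof.
move=> p0 a0 b0 h0 h1; elim: N k => [|N IH] k /=.
  rewrite expn0 expr0 divr1; case: k => [|[|//]] _.
    by rewrite subr0 powRr1 ?(ltW a0) // powRr0 mulr1.
  by rewrite subrr powRr0 mul1r powRr1 // ltW.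
have e2 : 2 ^+ N != 0 :> R by rewrite expf_neq0.
(* An even numerator already occurs at level [N]. An odd one is the midpoint of two neighbours of
   level [N], and the square root averages their exponents. *)
rewrite -(odd_double_half k) expnS; case: (odd k); last first.
  rewrite add0n -mul2n leq_pmul2l // => /IH /=; rewrite natrM exprS.
  by have -> : 2%:R * k./2%:R / (2 * 2 ^+ N) = k./2%:R / 2 ^+ N :> R by field.
rewrite add1n -mul2n ltn_pmul2l // => kN.
have := IH _ kN; have := IH _ (ltnW kN) => /=.
set s := k./2%:R / _; set t := k./2.+1%:R / _ => hs ht.
have st : s < t by rewrite /s /t ltr_pM2r ?invr_gt0 ?exprn_gt0 // ltr_nat.
have s0 : 0 <= s by rewrite divr_ge0 // exprn_ge0.
have -> : (2 * k./2).+1%:R / 2 ^+ N.+1 = (s + t) / 2 :> R.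
  by rewrite /s /t -!natr1 natrM exprS; field.
have cp u : 0 < a `^ (1 - u) * b `^ u by rewrite mulr_gt0 // powR_gt0.
have := sandwich_midpoint p0 s0 st (cp s) (cp t) hs ht.
rewrite -powR12_sqrt ?mulr_ge0 ?powR_ge0 //.
rewrite mulrACA -!powRD ?(gt_eqF a0) ?(gt_eqF b0) ?implybT //.
rewrite powRM ?powR_ge0 // -!powRrM.
by rewrite (_ : (1 - s + (1 - t)) / 2 = 1 - (s + t) / 2) //; field.
Qed.

Lemma Re_ip_sandwich A p s x y :
  complex.Re (ip (sandwich A p s *m x) y) =
  \sum_i \sum_j (p i `^ s * p j `^ s) * complex.Re (A i j * x j 0 * conjc (y i 0)).
Proof.
rewrite /ip raddf_sum; apply: eq_bigr => i _.
rewrite /sandwich /dpow -!mulmxA diag_mx_col !mxE mulr_sumr mulr_suml raddf_sum.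
apply: eq_bigr => j _; rewrite diag_mx_col !mxE.
set z := A i j; set w := x j 0; set v := conjc _.
have -> : (p i `^ s)%:C%C * (z * ((p j `^ s)%:C%C * w)) * v =
  (p i `^ s * p j `^ s)%:C%C * (z * w * v) by rewrite rmorphM /=; ring.
by case: (z * w * v) => ? ? /=; rewrite mul0r subr0.
Qed.

(** The dyadic exponents [u N], which are [s] cut to [N] binary digits, tend to [s]. Tested on fixed
    vectors, both sides of the dyadic bound are continuous in the exponent at [s > 0]. *)
Lemma sandwich_interpolation A p (a b s : R) : (forall i, 0 <= p i) ->
  0 < a -> 0 < b -> opb (sandwich A p 0) a -> opb (sandwich A p 1) b ->
  0 < s -> s <= 1 -> opb (sandwich A p s) (a `^ (1 - s) * b `^ s).
Proof.
move=> p0 a0 b0 h0 h1 s0 s1.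
apply/opb_ip => [|x y]; first by rewrite mulr_ge0 ?powR_ge0.
pose k N := Num.trunc (s * 2 ^+ N).
pose u N : R := (k N)%:R / 2 ^+ N.
have e2 N : 0 < 2 ^+ N :> R by rewrite exprn_gt0.
have kN N : ((k N)%:R <= s * 2 ^+ N < (k N).+1%:R)%R.
  by apply: truncn_itv; rewrite mulr_ge0 ?ltW.
have us : u @ \oo --> s.
  apply/cvgrPdist_le => e e0.
  have : \forall N \near \oo, (2^-1 : R) ^+ N <= e.
    have := @cvg_expr R 2^-1; rewrite ger0_norm ?invr_ge0 // invf_lt1 // ltr1n => /(_ isT).
    by move=> /cvgr0Pnorm_le /(_ e e0); apply: filterS => N; rewrite ger0_norm // exprn_ge0 // invr_ge0.
  apply: filterS => N; apply: le_trans; have /andP[l r] := kN N.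
  rewrite ger0_norm ?subr_ge0 /u ?ler_pdivrMr //.
  rewrite exprVn -[leRHS]mul1r lerBlDr -mulrDl ler_pdivlMr //.
  by rewrite addrC natr1 ltW.
have le N : complex.Re (ip (sandwich A p (u N) *m x) y) <=
    a `^ (1 - u N) * b `^ u N * vnorm x * vnorm y.
  have kN2 : (k N <= 2 ^ N)%N.
    rewrite -(ler_nat R) natrX; have /andP[l _] := kN N; apply: le_trans l _.
    by rewrite ler_piMl // ltW.
  have := sandwich_dyadic p0 a0 b0 h0 h1 kN2 => /= /opb_ip; apply.
  by rewrite mulr_ge0 ?powR_ge0.
have cl : complex.Re (ip (sandwich A p (u N) *m x) y) @[N --> \oo] -->
    complex.Re (ip (sandwich A p s *m x) y).
  under eq_cvg do rewrite Re_ip_sandwich.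
  rewrite Re_ip_sandwich; apply: cvg_sum => i; apply: cvg_sum => j.
  by apply: cvgMl; apply: cvgM; exact: (cvg_powR_exponent s0 us).
have cr : (a `^ (1 - u N) * b `^ u N * vnorm x * vnorm y) @[N --> \oo] -->
    a `^ (1 - s) * b `^ s * vnorm x * vnorm y.
  apply: cvgMl; apply: cvgMl; apply: cvgM; last exact: (cvg_powR_exponent s0 us).
  under eq_cvg do rewrite powRB ?(gt_eqF a0) ?implybT //.
  rewrite powRB ?(gt_eqF a0) ?implybT //.
  apply: cvgMr; apply: cvgV; first by rewrite gt_eqF // powR_gt0.
  exact: (cvg_powR_exponent s0 us).
by apply: ler_cvg_to cl cr _; exact: nearW.
Qed.

End interpolation.

(** * Weighted matrices: the Hilbert-Schmidt endpoint and its interpolation *)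

Section weighted.
Context (R : realType) (n : nat).
Local Notation C := R[i].
Implicit Types (A : 'M[C]_n) (w : 'I_n -> R).

Definition wmx w : 'M[C]_n := diag_mx (\row_i (w i)%:C%C).

(** The entries are dominated by those of the rank-one matrix g w_i w_j, whose norm is g times the
    squared length of [w]. *)
Lemma opb_hilbert_schmidt A w (g : R) : 0 <= g ->
  (forall i j, modulus (A i j) <= g) -> (forall i, 0 <= w i) ->
  opb (wmx w *m A *m wmx w) (g * \sum_i w i ^+ 2).
Proof.
move=> g0 Ag w0 x; have S0 : 0 <= \sum_i w i ^+ 2 by apply: sumr_ge0 => i _; exact: sqr_ge0.
have gS0 : 0 <= g * \sum_i w i ^+ 2 by exact: mulr_ge0.
rewrite -ler_sqr ?nnegrE ?vnorm_ge0 //; last exact: mulr_ge0 (vnorm_ge0 _).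
set T := \sum_i w i * modulus (x i 0).
have T0 : 0 <= T by apply: sumr_ge0 => i _; rewrite mulr_ge0 ?modulus_ge0.
have T2 : T ^+ 2 <= (\sum_i w i ^+ 2) * vnorm x ^+ 2.
  by rewrite sqr_vnorm; exact: sum_cauchy_schwarz.
rewrite sqr_vnorm; apply: (@le_trans _ _ (\sum_i w i ^+ 2 * (g ^+ 2 * T ^+ 2))).
  apply: ler_sum => i _; rewrite -!exprMn ler_sqr ?nnegrE ?modulus_ge0 ?mulr_ge0 //.
  rewrite -!mulmxA diag_mx_col modulusM !mxE modulus_real ger0_norm //.
  rewrite ler_wpM2l //; apply: le_trans (modulus_sum _) _.
  rewrite mulr_sumr; apply: ler_sum => j _.
  rewrite diag_mx_col modulusM !mxE modulusM modulus_real ger0_norm //.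
  by rewrite ler_wpM2r // mulr_ge0 ?modulus_ge0.
rewrite -mulr_suml !exprMn mulrCA -mulrA ler_wpM2l ?sqr_ge0 //.
by rewrite [in leRHS]expr2 -mulrA ler_wpM2l.
Qed.

(** With [p i = w i]^ r[the exponents 0, 1 and]r^-1[yield]A[, the Hilbert-Schmidt case with weights
    of square]w i [^ (2 * r)], and the weight [w] itself. A positive majorant [S] replaces the sum
    because interpolation asks for positive endpoint constants. *)
Lemma opb_weighted A w (r g D S : R) : 1 <= r -> 0 < g -> 0 < D -> 0 < S ->
  (forall i j, modulus (A i j) <= g) -> opb A D -> (forall i, 0 <= w i) ->
  \sum_i w i `^ (2 * r) <= S ->
  opb (wmx w *m A *m wmx w) (D `^ (1 - r^-1) * (g * S) `^ r^-1).
Proof.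
move=> r1 g0 D0 S0 Ag AD w0 wS; have r0 : 0 < r by exact: lt_le_trans r1.
pose p i := w i `^ r; have p0 i : 0 <= p i by exact: powR_ge0.
have H0 : opb (sandwich A p 0) D.
  suff -> : sandwich A p 0 = A by [].
  rewrite /sandwich (_ : dpow p 0 = 1%:M) ?mulmx1 ?mul1mx //.
  by apply/matrixP => i j; rewrite !mxE powRr0.
have H1 : opb (sandwich A p 1) (g * S).
  apply: (@opb_le _ _ _ (g * \sum_i p i ^+ 2)).
    apply: ler_wpM2l; first exact: ltW. apply: le_trans wS; apply: ler_sum => i _.
    by rewrite mulrC powRrM powR_mulrn ?powR_ge0.
  rewrite /sandwich (_ : dpow p 1 = wmx p); last first.
    by apply/matrixP => i j; rewrite !mxE powRr1.
  by apply: opb_hilbert_schmidt => //; exact: ltW.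
have := sandwich_interpolation p0 D0 (mulr_gt0 g0 S0) H0 H1.
move=> /(_ r^-1); rewrite invr_gt0 invf_le1 // => /(_ r0 r1).
rewrite /sandwich (_ : dpow p r^-1 = wmx w) //.
have pE i : p i `^ r^-1 = w i by rewrite -powRrM mulfV ?gt_eqF // powRr1.
by apply/matrixP => i j; rewrite !mxE pE.
Qed.

Lemma opb_wmx w (c : R) : (forall i, 0 <= w i <= c) -> 0 <= c -> opb (wmx w) c.
Proof.
move=> wc c0; apply: opb_diag => // i; have /andP[? ?] := wc i.
by rewrite mxE modulus_real ger0_norm.
Qed.

End weighted.

(** * Finite windows of the integers *)

Section windows.
Context (R : realType).
Local Notation C := R[i].

Definition idx N (i : 'I_N.*2.+1) : int := i%:Z - N%:Z.

Definition wsum (V : zmodType) (F : int -> V) N := \sum_(i < N.*2.+1) F (idx i).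

Lemma wsum0 (V : zmodType) (F : int -> V) : wsum F 0 = F 0.
Proof. by rewrite /wsum big_ord1. Qed.

Lemma wsumS (V : zmodType) (F : int -> V) N :
  wsum F N.+1 = wsum F N + (F N.+1%:Z + F (- N.+1%:Z)).
Proof.
rewrite /wsum /idx doubleS big_ord_recl big_ord_recr /=.
rewrite [LHS]addrC -[LHS]addrA; congr (_ + (_ + _)).
- by apply: eq_bigr => i _; congr F; rewrite /bump /=; lia.
- by congr F; rewrite /bump /=; lia.
- by congr F; lia.
Qed.

Lemma idx_bound N (i : 'I_N.*2.+1) : (absz (idx i) <= N)%N.
Proof. by rewrite /idx; have := ltn_ord i; lia. Qed.

Lemma idx_inj N : injective (@idx N).
Proof. by move=> i j; rewrite /idx => ij; apply: val_inj; rewrite /=; lia. Qed.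

Lemma idx_surj N (m : int) : (absz m <= N)%N -> exists i, @idx N i = m.
Proof.
move=> mN; have h : (absz (m + N%:Z)%R < N.*2.+1)%N by lia.
by exists (Ordinal h); rewrite /idx /=; lia.
Qed.

Lemma le_wsum (F : int -> R) M N : (forall m, 0 <= F m) -> (M <= N)%N ->
  wsum F M <= wsum F N.
Proof.
move=> F0; elim: N => [|N IH]; first by rewrite leqn0 => /eqP ->.
rewrite leq_eqVlt => /orP[/eqP -> //|]; rewrite ltnS => /IH h.
by apply: le_trans h _; rewrite wsumS lerDl addr_ge0.
Qed.

Lemma wsum_ge0 (F : int -> R) N : (forall m, 0 <= F m) -> 0 <= wsum F N.
Proof. by move=> F0; apply: sumr_ge0. Qed.

Definition wcol N (x : int -> C) : 'cV[C]_N.*2.+1 := \col_i x (idx i).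

Lemma sqr_vnorm_wcol N (x : int -> C) :
  vnorm (wcol N x) ^+ 2 = wsum (fun m => modulus (x m) ^+ 2) N.
Proof. by rewrite sqr_vnorm; apply: eq_bigr => i _; rewrite mxE. Qed.

(** Extension by zero, written with Kronecker deltas so that it combines with [gpot] term by term in
    [gpotP]. *)
Definition ext N (h : 'cV[C]_N.*2.+1) (m : int) : C :=
  \sum_j (m == idx j)%:R * h j 0.

Lemma ext_idx N (h : 'cV[C]_N.*2.+1) i : ext h (idx i) = h i 0.
Proof.
rewrite /ext (bigD1 i) //= eqxx mul1r big1 ?addr0 // => j ji.
by rewrite (inj_eq (@idx_inj N)) eq_sym (negbTE ji) mul0r.
Qed.

Lemma ext_out N (h : 'cV[C]_N.*2.+1) m : (N < absz m)%N -> ext h m = 0.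
Proof.
move=> Nm; rewrite /ext big1 // => j _; case: eqP => [mj|_]; rewrite ?mul0r //.
by have := idx_bound j; rewrite -mj leqNgt Nm.
Qed.

Lemma wcol_ext N (h : 'cV[C]_N.*2.+1) : wcol N (ext h) = h.
Proof. by apply/matrixP => i j; rewrite (ord1 j) mxE ext_idx. Qed.

Lemma vnorm_wcol_ext N M (h : 'cV[C]_N.*2.+1) : vnorm (wcol M (ext h)) <= vnorm h.
Proof.
rewrite -ler_sqr ?nnegrE ?vnorm_ge0 // -[in leRHS](wcol_ext h) !sqr_vnorm_wcol.
have F0 m : 0 <= modulus (ext h m) ^+ 2 by exact: sqr_ge0.
have [MN|NM] := leqP M N; first exact: le_wsum.
elim: M NM => // M IH; rewrite ltnS leq_eqVlt wsumS => NM.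
rewrite !ext_out ?modulus0 ?expr0n ?addr0 /=; try lia.
by case/orP: NM => [/eqP NM|/IH //]; apply: le_wsum; rewrite // NM.
Qed.

End windows.

(** * Green's function of the Laplacian *)

Section green.
Context (R : realType) (k : R[i]).
Local Notation C := R[i].
Hypothesis k0 : 0 < modulus k.
Hypothesis k1 : modulus k < 1.

Definition green (m n : int) : C := k ^+ absz (m - n) / (k - k^-1).

Lemma k_neq0 : k != 0.
Proof. by apply/eqP => kz; move: k0; rewrite kz modulus0 ltxx. Qed.

Lemma kVk_neq0 : k - k^-1 != 0.
Proof.
rewrite subr_eq0; apply/eqP => h.
have : modulus (k * k) = 1 by rewrite {2}h mulfV ?k_neq0 ?modulus1.
by rewrite modulusM; have := k0; have := k1; nra.
Qed.

(** Off the diagonal the powers of [k] solve the homogeneous recurrence. On it, 2k - (k + k^-1) = k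
    - k^-1 is what the denominator of [green] normalises to 1. *)
Lemma greenP m n :
  green (m + 1) n + green (m - 1) n - (k + k^-1) * green m n = (m == n)%:R.
Proof.
have := kVk_neq0; have := k_neq0 => kn0 kV.
have k21 : k ^+ 2 - 1 != 0.
  by apply: contra_neq kV => k2; apply: (mulfI kn0); rewrite mulr0 mulrBr mulfV // -expr2.
rewrite /green (_ : m + 1 - n = m - n + 1); last by ring.
rewrite (_ : m - 1 - n = m - n - 1); last by ring.
rewrite -(subr_eq0 m n).
case: (m - n) => [[|d]|d].
- by rewrite add0r sub0r /= expr1 ; field; rewrite k21 kn0.
- rewrite (_ : absz (Posz d.+1 + 1) = d.+2); last by lia.
  rewrite (_ : absz (Posz d.+1 - 1) = d); last by lia.
  rewrite (_ : absz (Posz d.+1) = d.+1) //= !exprS.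
  by field; rewrite k21 kn0.
- rewrite (_ : absz (Negz d + 1) = d); last by lia.
  rewrite (_ : absz (Negz d - 1) = d.+2); last by lia.
  rewrite (_ : absz (Negz d) = d.+1) //= !exprS.
  by field; rewrite k21 kn0.
Qed.

Lemma modulus_green m n : modulus (green m n) = modulus k ^+ absz (m - n) / modulus (k - k^-1).
Proof.
rewrite /green modulusM {2}/modulus ComplexField.Normc.normcV; congr (_ / _).
by elim: (absz _) => [|d IH]; rewrite ?expr0 ?modulus1 // !exprS modulusM IH.
Qed.

Lemma kVk_gt0 : 0 < modulus (k - k^-1).
Proof.
rewrite lt_def modulus_ge0 andbT; apply/eqP => /modulus_eq0 /eqP.
by rewrite (negbTE kVk_neq0).
Qed.

Lemma green_le m n : modulus (green m n) <= (modulus (k - k^-1))^-1.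
Proof.
rewrite modulus_green ler_piMl ?invr_ge0 ?modulus_ge0 //.
by rewrite exprn_ile1 ?modulus_ge0 // ltW.
Qed.

(** The values are taken on all of Z, so that the free equation has no truncation error; [greenmx]
    describes only the part inside the window. *)
Definition gpot N (h : 'cV[C]_N.*2.+1) (m : int) : C :=
  \sum_j green m (idx j) * h j 0.

Definition greenmx N : 'M[C]_N.*2.+1 := \matrix_(i, j) green (idx i) (idx j).

Lemma wcol_gpot N (h : 'cV[C]_N.*2.+1) : wcol N (gpot h) = greenmx N *m h.
Proof.
apply/matrixP => i j; rewrite (ord1 j) !mxE; apply: eq_bigr => l _.
by rewrite !mxE.
Qed.

Lemma gpotP N (h : 'cV[C]_N.*2.+1) m :
  gpot h (m + 1) + gpot h (m - 1) = (k + k^-1) * gpot h m + ext h m.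
Proof.
rewrite /gpot /ext mulr_sumr -!big_split /=; apply: eq_bigr => j _.
by rewrite -greenP; ring.
Qed.

Lemma gpot_vanish N (h : 'cV[C]_N.*2.+1) :
  (modulus (gpot h M%:Z) @[M --> \oo] --> (0 : R)) /\
  (modulus (gpot h (- M%:Z)) @[M --> \oo] --> (0 : R)).
Proof.
suff main (f : nat -> int) : (forall M, absz (f M) = M) ->
    modulus (gpot h (f M)) @[M --> \oo] --> (0 : R).
  by split; apply: main => M; lia.
move=> fM.
pose K := \sum_j (modulus (k - k^-1))^-1 * modulus (h j 0).
(* A point of absolute value [M] is at least [M - N] away from the window; for [M < N] the truncated
   subtraction gives the trivial factor 1. *)
have lim : modulus k ^+ (M - N) * K @[M --> \oo] --> (0 : R).
  rewrite -(mul0r K); apply: cvgMl; rewrite -(cvg_shiftn N).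
  under eq_cvg do rewrite /= addnK.
  by apply: cvg_expr; rewrite ger0_norm // ltW.
apply: squeeze_cvgr (cvg_cst (0 : R)) lim; apply: nearW => M.
rewrite modulus_ge0 /=; apply: le_trans (modulus_sum _) _.
rewrite mulr_sumr; apply: ler_sum => j _.
rewrite modulusM modulus_green -mulrA ler_wpM2r ?mulr_ge0 ?invr_ge0 ?modulus_ge0 //.
apply: ler_wiXn2l; rewrite ?modulus_ge0 // ?(ltW k1) //.
by have := idx_bound j; have := fM M; lia.
Qed.

End green.

(** * The norm of the Green operator through the numerical range *)

Section numerical_range.
Context (R : realType).
Local Notation C := R[i].
Implicit Types (x : int -> C).

Lemma cross_term (a b : C) : exists2 t : R,
  conjc a * b + conjc b * a = t%:C%C & `|t| <= modulus a ^+ 2 + modulus b ^+ 2.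
Proof.
case: a b => a1 a2 [b1 b2]; exists (2 * (a1 * b1 + a2 * b2)).
  by apply/eqP; rewrite eq_complex /=; apply/andP; split; apply/eqP; ring.
rewrite !sqr_modulus /= ler_norml.
have := sqr_ge0 (a1 - b1); have := sqr_ge0 (a2 - b2).
have := sqr_ge0 (a1 + b1); have := sqr_ge0 (a2 + b2).
by move=> *; apply/andP; split; nra.
Qed.

(** The couplings of both endpoints to their neighbours outside the window: what the cut-off adds to
    an otherwise real quadratic form. *)
Definition bdry x (M : nat) : C :=
  conjc (x M%:Z) * x (M%:Z + 1) + conjc (x (- M%:Z)) * x (- M%:Z - 1).

(* The quadratic form of the Laplacian restricted to a window, up to the
   boundary terms, is real and has values in [[-2, 2]] on unit vectors. *)
Lemma wsum_laplacian x M : exists2 t : R,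
  wsum (fun m => conjc (x m) * (x (m + 1) + x (m - 1))) M = t%:C%C + bdry x M &
  `|t| <= 2 * wsum (fun m => modulus (x m) ^+ 2) M -
          modulus (x M%:Z) ^+ 2 - modulus (x (- M%:Z)) ^+ 2.
Proof.
elim: M => [|M [t tE tle]].
  exists 0; first by rewrite wsum0 /bdry oppr0 add0r sub0r add0r mulrDr.
  by rewrite wsum0 oppr0 normr0; lra.
have [u uE ule] := cross_term (x M%:Z) (x M.+1%:Z).
have [v vE vle] := cross_term (x (- M%:Z)) (x (- M.+1%:Z)).
exists (t + u + v).
  rewrite wsumS tE !rmorphD /= -uE -vE /bdry.
  have -> : M%:Z + 1 = M.+1%:Z by lia.
  have -> : - M%:Z - 1 = - M.+1%:Z by lia.
  have -> : M.+1%:Z - 1 = M%:Z by lia.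
  have -> : - M.+1%:Z + 1 = - M%:Z by lia.
  by ring.
rewrite wsumS; apply: le_trans (ler_normD _ _) _.
apply: le_trans (lerD (ler_normD _ _) (lexx _)) _.
by move: tle ule vle; lra.
Qed.

Lemma modulus_sub_segment (l : C) (d t S : R) : 0 <= S -> `|t| <= 2 * S ->
  (forall s : R, -2 <= s <= 2 -> d <= modulus (l - s%:C%C)) ->
  d * S <= modulus (l * S%:C%C - t%:C%C).
Proof.
move=> S0 tS hd; have [->|Sn0] := eqVneq S 0; first by rewrite mulr0 modulus_ge0.
have Sp : 0 < S by rewrite lt_def Sn0.
have -> : l * S%:C%C - t%:C%C = (l - (t / S)%:C%C) * S%:C%C.
  by rewrite mulrBl -rmorphM /= divfK.
rewrite modulusM modulus_real ger0_norm // ler_wpM2r // hd //.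
by move: tS; rewrite ler_norml ler_pdivlMr // ler_pdivrMr //; lra.
Qed.

Lemma wsum_conjM x y M :
  wsum (fun m => conjc (x m) * y m) M = ip (wcol M y) (wcol M x).
Proof. by apply: eq_bigr => i _; rewrite !mxE mulrC. Qed.

Context (k : C) (d : R).
Hypothesis k0 : 0 < modulus k.
Hypothesis k1 : modulus k < 1.
Hypothesis d0 : 0 < d.
Hypothesis hd : forall s : R, -2 <= s <= 2 -> d <= modulus (k + k^-1 - s%:C%C).

(** Pairing [gpotP] with [x] over the window turns l S - t, where l = k + k^-1, S is the squared
    norm and t the real form, into [bdry] minus the pairing with the source. By
    [modulus_sub_segment] its modulus is at least d S. *)
Lemma gpot_window N (h : 'cV[C]_N.*2.+1) M :
  d * vnorm (wcol M (gpot k h)) ^+ 2 <=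
  modulus (bdry (gpot k h) M) + vnorm (wcol M (gpot k h)) * vnorm h.
Proof.
set x := gpot k h; have [t tE tle] := wsum_laplacian x M.
have S0 : 0 <= wsum (fun m => modulus (x m) ^+ 2) M.
  by apply: wsum_ge0 => m; exact: sqr_ge0.
have t2 : `|t| <= 2 * wsum (fun m => modulus (x m) ^+ 2) M.
  apply: le_trans tle _; have := sqr_ge0 (modulus (x M%:Z)).
  by have := sqr_ge0 (modulus (x (- M%:Z))); lra.
rewrite sqr_vnorm_wcol; apply: le_trans (modulus_sub_segment S0 t2 hd) _.
have SE : (wsum (fun m => modulus (x m) ^+ 2) M)%:C%C =
    wsum (fun m => conjc (x m) * x m) M.
  by rewrite wsum_conjM ipxx sqr_vnorm_wcol.
have -> : (k + k^-1) * (wsum (fun m => modulus (x m) ^+ 2) M)%:C%C - t%:C%C =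
    bdry x M - wsum (fun m => conjc (x m) * ext h m) M.
  apply/eqP; rewrite subr_eq addrAC eq_sym subr_eq addrC eq_sym -tE SE.
  rewrite /wsum mulr_sumr -big_split; apply/eqP; apply: eq_bigr => i _ /=.
  by rewrite gpotP // -/x; ring.
apply: le_trans (modulusD _ _) _; rewrite modulusN lerD2l wsum_conjM.
apply: le_trans (modulus_ip _ _) _; rewrite mulrC ler_wpM2l ?vnorm_ge0 //.
exact: vnorm_wcol_ext.
Qed.

Lemma bdry_gpot N (h : 'cV[C]_N.*2.+1) :
  modulus (bdry (gpot k h) M) @[M --> \oo] --> (0 : R).
Proof.
have [v1 v2] := gpot_vanish k0 k1 h.
have s1 := v1; have s2 := v2; rewrite -(cvg_shiftn 1) in s1; rewrite -(cvg_shiftn 1) in s2.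
have lim : modulus (gpot k h M%:Z) * modulus (gpot k h (M + 1)%:Z) +
  modulus (gpot k h (- M%:Z)) * modulus (gpot k h (- (M + 1)%:Z)) @[M --> \oo] --> (0 : R).
  have -> : (0 : R) = 0 * 0 + 0 * 0 by rewrite mulr0 addr0.
  by apply: cvgD; apply: cvgM.
apply: squeeze_cvgr (cvg_cst (0 : R)) lim; apply: nearW => M.
rewrite modulus_ge0 /=; apply: le_trans (modulusD _ _) _.
rewrite !modulusM !modulusJ.
by rewrite (_ : - M%:Z - 1 = - (M + 1)%:Z) //; lia.
Qed.

Lemma vnorm_gpot N (h : 'cV[C]_N.*2.+1) M :
  vnorm (wcol M (gpot k h)) <= d^-1 * vnorm h.
Proof.
rewrite mulrC ler_pdivlMr // mulrC.
have [->|s0] := eqVneq (vnorm (wcol M (gpot k h))) 0; first by rewrite mulr0 vnorm_ge0.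
set s := vnorm _ in s0 *.
have sp : 0 < s by rewrite lt_def s0 vnorm_ge0.
(* The larger window [P] tends to infinity while [s] stays fixed. Dividing by [s <= S] makes the
   boundary term vanish without any upper bound on [S]. *)
have lim : modulus (bdry (gpot k h) P) / s + vnorm h @[P --> \oo] --> vnorm h.
  have {2}-> : vnorm h = 0 / s + vnorm h by rewrite mul0r add0r.
  by apply: cvgD; [apply: cvgMl; exact: bdry_gpot|exact: cvg_cst].
apply: ler_cvg_to (cvg_cst (d * s)) lim _.
have : \forall P \near \oo, (M <= P)%N by exact: nbhs_infty_ge.
apply: filterS => P MP; set S := vnorm (wcol P (gpot k h)).
have sS : s <= S.
  rewrite -ler_sqr ?nnegrE ?vnorm_ge0 // !sqr_vnorm_wcol le_wsum // => m.
  exact: sqr_ge0.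
have Sp : 0 < S by exact: lt_le_trans sS.
apply: (@le_trans _ _ (d * S)); first by rewrite ler_pM2l.
apply: (@le_trans _ _ (modulus (bdry (gpot k h) P) / S + vnorm h)).
  rewrite -(ler_pM2r Sp) mulrDl divfK ?gt_eqF // [vnorm h * _]mulrC -mulrA -expr2.
  exact: gpot_window.
by rewrite lerD2r ler_wpM2l ?modulus_ge0 // lef_pV2.
Qed.

Lemma opb_greenmx N : opb (greenmx k N) d^-1.
Proof. by move=> h; rewrite -wcol_gpot; exact: vnorm_gpot. Qed.

End numerical_range.

(** * The Birman-Schwinger principle *)

Section finite_solution.
Context (R : realType).
Local Notation C := R[i].

(** In finite dimension injectivity is enough: a kernel vector satisfies ||x|| = ||B x|| <= c ||x||.
    The transposes appear because [row_free] concerns the left kernel. *)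
Lemma unitmx_opb n (B : 'M[C]_n) (c : R) : c < 1 -> opb B c -> 1%:M + B \in unitmx.
Proof.
move=> c1 hB; rewrite -unitmx_tr -row_free_unit; apply: inj_row_free => u uB.
have Bu : (1%:M + B) *m u^T = 0 by apply: trmx_inj; rewrite trmx_mul trmxK uB trmx0.
apply: trmx_inj; rewrite trmx0; apply: vnorm_eq0; apply/le_anti.
rewrite vnorm_ge0 andbT; have := hB u^T.
have -> : B *m u^T = - u^T.
  by apply/eqP; rewrite -subr_eq0 opprK addrC -{1}[u^T]mul1mx -mulmxDl Bu.
by rewrite vnormN; have := vnorm_ge0 u^T; nra.
Qed.

Lemma perturbation_bound (S c s : R) : c < 1 -> S <= s + c * S -> S <= (1 - c)^-1 * s.
Proof. by move=> c1 h; rewrite mulrC ler_pdivlMr ?subr_gt0 //; lra. Qed.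

(* [u = W A h] solves the Birman-Schwinger equation [(1 + W A W Z) u = W A f]. *)
Lemma birman_schwinger n (A W Z : 'M[C]_n) (f : 'cV[C]_n) (a c q : R) :
  0 <= a -> 0 <= c -> 0 <= q -> q < 1 -> opb A a -> opb W c -> opb Z 1 ->
  opb (W *m A *m W) q ->
  exists2 h, h = f - W *m (Z *m (W *m (A *m h))) &
    vnorm h <= (1 + c * ((1 - q)^-1 * (c * a))) * vnorm f.
Proof.
move=> a0 c0 q0 q1 hA hW hZ hK.
have hKZ : opb (W *m A *m W *m Z) q by rewrite -[q]mulr1; exact: opbM.
have E1 := unitmx_opb q1 hKZ.
have [u uE] : exists u, u = W *m (A *m f) - W *m A *m W *m Z *m u.
  exists (invmx (1%:M + W *m A *m W *m Z) *m (W *m (A *m f))).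
  move: (W *m (A *m f)) => s; set u := _ *m s.
  apply/eqP; rewrite eq_sym subr_eq; apply/eqP.
  by rewrite -{1}[u]mul1mx -mulmxDl /u mulKVmx.
have u_le : vnorm u <= (1 - q)^-1 * (c * a) * vnorm f.
  rewrite -mulrA; apply: perturbation_bound => //.
  rewrite {1}uE; apply: le_trans (vnormD _ _) _; rewrite vnormN; apply: lerD => //.
  apply: le_trans (hW (A *m f)) _; rewrite -mulrA; apply: ler_wpM2l => //; exact: hA.
have Wu : W *m (A *m (f - W *m (Z *m u))) = u.
  by rewrite [RHS]uE !mulmxBr !mulmxA.
exists (f - W *m (Z *m u)); first by rewrite Wu.
apply: le_trans (vnormD _ _) _; rewrite vnormN mulrDl mul1r lerD2l -mulrA.
apply: le_trans (hW _) (ler_wpM2l c0 _).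
by apply: le_trans (hZ u) _; rewrite mul1r.
Qed.

Context (v : int -> C).

Definition wgt (m : int) : R := Num.sqrt (modulus (v m)).

(** The polar factor of [v m]; it is 0 where [v] vanishes, since division by 0 yields 0. *)
Definition phase (m : int) : C := v m / (modulus (v m))%:C%C.

Lemma wgt_ge0 m : 0 <= wgt m. Proof. exact: sqrtr_ge0. Qed.

Lemma sqr_wgt m : wgt m ^+ 2 = modulus (v m).
Proof. by rewrite sqr_sqrtr // modulus_ge0. Qed.

Lemma wgt_phase m : (wgt m)%:C%C * phase m * (wgt m)%:C%C = v m.
Proof.
rewrite mulrAC -rmorphM -expr2 /= sqr_wgt mulrC /phase.
have [v0|v0] := eqVneq (modulus (v m)) 0; last first.
  by rewrite divfK //; apply: contra_neq v0 => /complexI.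
by rewrite v0 mulr0; rewrite (modulus_eq0 v0).
Qed.

Lemma modulus_phase m : modulus (phase m) <= 1.
Proof.
rewrite /phase modulusM {2}/modulus ComplexField.Normc.normcV -/(modulus _).
rewrite modulus_real ger0_norm ?modulus_ge0 //.
have [->|v0] := eqVneq (modulus (v m)) 0; first by rewrite mul0r.
by rewrite divff.
Qed.

Context (k : C) (d kap c : R).
Hypothesis k0 : 0 < modulus k.
Hypothesis k1 : modulus k < 1.
Hypothesis d0 : 0 < d.
Hypothesis hd : forall s : R, -2 <= s <= 2 -> d <= modulus (k + k^-1 - s%:C%C).
Hypothesis kap0 : 0 <= kap.
Hypothesis kap1 : kap < 1.
Hypothesis c0 : 0 <= c.
Hypothesis wc : forall m, wgt m <= c.
Hypothesis hkap : forall N, let W := wmx (fun i : 'I_N.*2.+1 => wgt (idx i)) in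
  opb (W *m greenmx k N *m W) kap.

(** The bound [d^-1] for the free resolvent times the constant of [birman_schwinger] with [a = d^-1]
    and [q = kap]. *)
Definition solbound : R := d^-1 * (1 + c * ((1 - kap)^-1 * (c * d^-1))).

Lemma solbound_ge0 : 0 <= solbound.
Proof.
have d1 : 0 <= d^-1 by rewrite invr_ge0 ltW.
have q1 : 0 <= (1 - kap)^-1 by rewrite invr_ge0 subr_ge0 ltW.
by rewrite /solbound mulr_ge0 // addr_ge0 // !mulr_ge0.
Qed.

(** The solution is the free potential of a source [h] on the window. The Birman-Schwinger equation
    forces h = f - v x there, so the perturbed equation holds inside the window; outside it the
    potential is in effect switched off. *)
Lemma window_solution N (f : int -> C) : exists x : int -> C,
  (forall m, (absz m <= N)%N ->
     x (m - 1) + x (m + 1) + v m * x m - (k + k^-1) * x m = f m) /\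
  (forall M, vnorm (wcol M x) <= solbound * vnorm (wcol N f)).
Proof.
have d1 : 0 <= d^-1 by rewrite invr_ge0 ltW.
have hW : opb (wmx (fun i : 'I_N.*2.+1 => wgt (idx i))) c.
  by apply: opb_wmx => // i; rewrite wgt_ge0 wc.
have hZ : opb (diag_mx (\row_(i < N.*2.+1) phase (idx i))) 1.
  by apply: opb_diag => // i; rewrite mxE modulus_phase.
have [h hE h_le] := birman_schwinger (wcol N f) d1 c0 kap0 kap1
  (opb_greenmx k0 k1 d0 hd (N := N)) hW hZ (@hkap N).
exists (gpot k h); split=> [m mN|M]; last first.
  apply: le_trans (vnorm_gpot k0 k1 d0 hd h M) _.
  by rewrite /solbound -mulrA; apply: ler_wpM2l.
have [i mE] := idx_surj mN.
rewrite [gpot k h (m - 1) + _]addrC (gpotP k0 k1) -mE ext_idx.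
have hi : h i 0 = f (idx i) - v (idx i) * gpot k h (idx i).
  rewrite {1}hE -wcol_gpot mxE [in X in _ + X]mxE !diag_mx_col !mxE -[v _]wgt_phase.
  by rewrite !mulrA.
by rewrite hi; ring.
Qed.

End finite_solution.

(** * Windows and norms of sequences *)

Section window_norms.
Context (R : realType).
Local Notation C := R[i].

Definition restr (F : int -> R) N (m : int) : R := if (absz m <= N)%N then F m else 0.

Lemma restr_sum (F : int -> R) N m :
  restr F N m = \sum_(j < N.*2.+1) F (idx j) * \1_[set idx j] m.
Proof.
rewrite /restr; case: ifPn => [/idx_surj[i <-]|mN].
  rewrite (bigD1 i) //= indicE mem_set // mulr1 big1 ?addr0 // => j ji.
  rewrite indicE memNset ?mulr0 //= => /(@idx_inj N) ij.
  by rewrite ij eqxx in ji.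
rewrite big1 // => j _; rewrite indicE memNset ?mulr0 //= => mj.
by move: mN; rewrite mj idx_bound.
Qed.

Lemma integral_restr (F : int -> R) N : (forall m, 0 <= F m) ->
  (\int[@counting int R]_m (restr F N m)%:E = (wsum F N)%:E)%E.
Proof.
move=> F0; under eq_integral do rewrite restr_sum -sumEFin.
rewrite ge0_integral_sum //; last first.
  by move=> j m _; rewrite lee_fin mulr_ge0 // indicE.
rewrite /wsum -sumEFin; apply: eq_bigr => j _.
under eq_integral do rewrite EFinM.
rewrite ge0_integralZl ?lee_fin //.
by rewrite integral_indic // setIT [X in (_ * X)%E]counting_set1 mule1.
Qed.

Lemma wsum_le_integral (F : int -> R) N : (forall m, 0 <= F m) ->
  ((wsum F N)%:E <= \int[@counting int R]_m (F m)%:E)%E.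
Proof.
move=> F0; rewrite -integral_restr //; by apply: ge0_le_integral => // m _; rewrite lee_fin /restr; case: ifP.
Qed.

Lemma integral_le_wsum (F : int -> R) (c : \bar R) : (forall m, 0 <= F m) ->
  (forall N, ((wsum F N)%:E <= c)%E) -> (\int[@counting int R]_m (F m)%:E <= c)%E.
Proof.
move=> F0 hc; pose g N m := (restr F N m)%:E.
have g0 N m : setT m -> (0%R <= g N m)%E.
  by move=> _; rewrite lee_fin /restr; case: ifP.
have gm m : setT m -> {homo g ^~ m : n p / (n <= p)%N >-> (n <= p)%E}.
  move=> _ n p np; rewrite lee_fin /restr; case: ifP => [mn|_].
    by rewrite (leq_trans mn np).
  by case: ifP.
have gF m : limn (g ^~ m) = (F m)%:E.
  apply: lim_near_cst => //.
  have : \forall N \near \oo, (absz m <= N)%N by exact: nbhs_infty_ge.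
  by apply: filterS => N mN; rewrite /g /restr mN.
have := @cvg_monotone_convergence _ _ _ (@counting int R) setT measurableT g _ g0 gm.
move=> /(_ (fun n => ltac:(by []))).
under [X in _ --> X -> _]eq_integral do rewrite gF.
move=> /cvg_lim <- //; apply: lime_le; last by apply: nearW => N; rewrite integral_restr.
apply: ereal_nondecreasing_is_cvgn => n p np.
by rewrite !integral_restr // lee_fin le_wsum.
Qed.

Lemma wsum_powR_le (r : R) (u : int -> C) N : 0 < r -> lp r%:E u ->
  wsum (fun m => modulus (u m) `^ r) N <= fine (lpnorm r%:E u) `^ r.
Proof.
move=> r0 ur.
have ufin : lpnorm r%:E u \is a fin_num by rewrite ge0_fin_numE ?lpnorm_ge0.
have F0 m : 0 <= modulus (u m) `^ r by exact: powR_ge0.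
rewrite -lee_fin -poweR_EFin fineK // lpnormE -poweRrM mulVf ?gt_eqF // poweRe1; last first.
  by apply: integral_ge0 => m _; rewrite lee_fin.
exact: wsum_le_integral.
Qed.

Lemma vnorm_wcol_le (u : int -> C) N : lp 2%:E u ->
  vnorm (wcol N u) <= fine (lpnorm 2%:E u).
Proof.
move=> u2; have L0 : 0 <= fine (lpnorm 2%:E u) by rewrite fine_ge0 ?lpnorm_ge0.
rewrite -ler_sqr ?nnegrE ?vnorm_ge0 // sqr_vnorm_wcol -powR_mulrn //.
apply: le_trans (wsum_powR_le N _ u2) => //.
by apply: ler_sum => i _; rewrite powR_mulrn ?modulus_ge0.
Qed.

Lemma lpnorm2_le (u : int -> C) (c : R) : 0 <= c ->
  (forall N, vnorm (wcol N u) <= c) -> (lpnorm 2%:E u <= c%:E)%E.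
Proof.
move=> c0 h; rewrite lpnormE.
have -> : c%:E = ((c ^+ 2)%:E `^ 2^-1)%E.
  by rewrite poweR_EFin powR12_sqrt ?sqr_ge0 // sqrtr_sqr ger0_norm.
apply: gt0_ler_poweR; rewrite ?in_itv /= ?leey ?andbT ?lee_fin ?sqr_ge0 //.
  by apply: integral_ge0 => m _; rewrite lee_fin powR_ge0.
apply: integral_le_wsum => [m|N]; first exact: powR_ge0.
rewrite lee_fin; apply: (@le_trans _ _ (vnorm (wcol N u) ^+ 2)).
  rewrite sqr_vnorm_wcol; apply: ler_sum => i _.
  by rewrite powR_mulrn ?modulus_ge0.
by rewrite ler_sqr ?nnegrE ?vnorm_ge0.
Qed.

(** The increments of the convergent sequence [wsum F] add the values of [F] at the two new
    endpoints, so both ends tend to 0. *)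
Lemma lp2_vanish (u : int -> C) : lp 2%:E u ->
  (modulus (u M%:Z) @[M --> \oo] --> (0 : R)) /\
  (modulus (u (- M%:Z)) @[M --> \oo] --> (0 : R)).
Proof.
move=> u2; pose F m := modulus (u m) ^+ 2.
have F0 m : 0 <= F m by exact: sqr_ge0.
have : cvgn (wsum F).
  apply: nondecreasing_is_cvgn; first by move=> n p np; exact: le_wsum.
  exists (fine (lpnorm 2%:E u) ^+ 2) => _ [N _ <-].
  rewrite -sqr_vnorm_wcol ler_sqr ?nnegrE ?vnorm_ge0 ?fine_ge0 ?lpnorm_ge0 //.
  exact: vnorm_wcol_le.
set l := limn _ => hl; have hS := hl; rewrite -(cvg_shiftn 1) in hS.
have inc : F M.+1%:Z + F (- M.+1%:Z) @[M --> \oo] --> (0 : R).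
  rewrite -(subrr l); under eq_cvg => M.
    rewrite (_ : F M.+1%:Z + _ = wsum F (M + 1) - wsum F M); last first.
      by rewrite addn1 wsumS addrAC subrr add0r.
    over.
  exact: cvgB.
have sq : Num.sqrt (F M.+1%:Z + F (- M.+1%:Z)) @[M --> \oo] --> (0 : R).
  by rewrite -sqrtr0; apply: continuous_cvg; [exact: sqrt_continuous|].
have sqF m : modulus (u m) = Num.sqrt (F m).
  by rewrite sqrtr_sqr ger0_norm ?modulus_ge0.
split; rewrite -(cvg_shiftn 1); apply: squeeze_cvgr (cvg_cst (0 : R)) sq;
  apply: nearW => M; rewrite modulus_ge0 /= sqF ler_wsqrtr // addn1.
  by rewrite lerDl.
by rewrite lerDr.
Qed.

End window_norms.

Lemma fmap_ultra (T T' : Type) (f : T -> T') (U : set_system T) :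
  UltraFilter U -> UltraFilter (fmap f U).
Proof.
move=> UU; split=> [|G GF UG]; first exact: fmap_proper_filter.
apply/predeqP => A; split=> [GA|]; last exact: UG.
have [//|UnA] := in_ultra_setVsetC (f @^-1` A) UU.
have /UG GnA : fmap f U (~` A) by [].
by have /filter_ex[? []] : G (A `&` ~` A) by exact: filterI.
Qed.

(** * Passage to the limit *)

Section pointwise_limit.
Context (R : realType).
Local Notation C := R[i].

(** Splitting into real and imaginary parts gives access to compactness of real segments and to
    limits in [R]. *)
Definition ccvg (U : set_system nat) (z : nat -> C) (l : C) :=
  (complex.Re (z N) @[N --> U] --> complex.Re l) /\
  (complex.Im (z N) @[N --> U] --> complex.Im l).

Lemma ReM (a b : C) :
  complex.Re (a * b) = complex.Re a * complex.Re b - complex.Im a * complex.Im b.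
Proof. by case: a b => ? ? [? ?]. Qed.

Lemma ImM (a b : C) :
  complex.Im (a * b) = complex.Re a * complex.Im b + complex.Im a * complex.Re b.
Proof. by case: a b => ? ? [? ?] /=; rewrite addrC. Qed.

Lemma ultrafilter_cvg (U : set_system nat) (a : nat -> R) (K : R) :
  UltraFilter U -> (forall N, `|a N| <= K) -> exists l : R, a N @[N --> U] --> l.
Proof.
move=> UU aK; have := @segment_compact R (- K) K; rewrite compact_ultra.
move=> /(_ (fmap a U) (fmap_ultra a UU)) []; last by move=> l [_ al]; exists l.
by rewrite /fmap /=; apply: filterE => N; rewrite /= in_itv /= -ler_norml; exact: aK.
Qed.

(** A single ultrafilter serves all coordinates at once, in place of a diagonal subsequence. *)
Lemma ultrafilter_ccvg (U : set_system nat) (X : nat -> int -> C) (K : R) :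
  UltraFilter U -> (forall N m, modulus (X N m) <= K) ->
  exists x, forall m, ccvg U (X^~ m) (x m).
Proof.
move=> UU XK; suff /choice[x xP] : forall m, exists l, ccvg U (X^~ m) l.
  by exists x.
move=> m.
have [a aP] := ultrafilter_cvg UU (fun N => le_trans (normRe_le_modulus _) (XK N m)).
have [b bP] := ultrafilter_cvg UU (fun N => le_trans (Im_le_modulus _) (XK N m)).
by exists (Complex a b).
Qed.

Lemma modulus_le_vnorm (x : int -> C) m : modulus (x m) <= vnorm (wcol (absz m) x).
Proof.
rewrite -ler_sqr ?nnegrE ?vnorm_ge0 ?modulus_ge0 // sqr_vnorm_wcol.
have [i iE] := @idx_surj (absz m) m (leqnn _).
by rewrite /wsum (bigD1 i) //= iE lerDl sumr_ge0 // => j _; exact: sqr_ge0.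
Qed.

Lemma vnorm_ccvg (U : set_system nat) (UU : ProperFilter U) (X : nat -> int -> C) x M (K : R) :
  0 <= K -> (forall m, ccvg U (X^~ m) (x m)) ->
  (forall N, vnorm (wcol M (X N)) <= K) -> vnorm (wcol M x) <= K.
Proof.
move=> K0 Xx h; rewrite -ler_sqr ?nnegrE ?vnorm_ge0 // sqr_vnorm_wcol.
have lim : wsum (fun m => modulus (X N m) ^+ 2) M @[N --> U] -->
    wsum (fun m => modulus (x m) ^+ 2) M.
  apply: cvg_sum => i; under eq_cvg do rewrite sqr_modulus.
  have [r j] := Xx (idx i); rewrite sqr_modulus.
  by apply: cvgD; rewrite expr2; under eq_cvg do rewrite expr2; apply: cvgM.
apply: ler_cvg_to lim (cvg_cst (K ^+ 2)) _; apply: nearW => N.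
by rewrite -sqr_vnorm_wcol ler_sqr ?nnegrE ?vnorm_ge0.
Qed.

Lemma ccvg_three_term (U : set_system nat) (UU : ProperFilter U)
    (z1 z2 z3 : nat -> C) (l1 l2 l3 a f : C) :
  ccvg U z1 l1 -> ccvg U z2 l2 -> ccvg U z3 l3 ->
  (\forall N \near U, z1 N + z2 N + a * z3 N = f) -> l1 + l2 + a * l3 = f.
Proof.
move=> [r1 i1] [r2 i2] [r3 i3] h.
apply/eqP; rewrite eq_complex; apply/andP; split; apply/eqP.
  have lim : complex.Re (z1 N + z2 N + a * z3 N) @[N --> U] -->
      complex.Re (l1 + l2 + a * l3).
    under eq_cvg do rewrite !raddfD /= ReM; rewrite !raddfD /= ReM.
    by apply: cvgD; [apply: cvgD|apply: cvgB; apply: cvgMr].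
  apply: (cvg_unique _ lim) => //; apply: cvg_near_cst.
  by apply: filterS h => N ->.
have lim : complex.Im (z1 N + z2 N + a * z3 N) @[N --> U] -->
    complex.Im (l1 + l2 + a * l3).
  under eq_cvg do rewrite !raddfD /= ImM; rewrite !raddfD /= ImM.
  by apply: cvgD; [apply: cvgD|apply: cvgD; apply: cvgMr].
apply: (cvg_unique _ lim) => //; apply: cvg_near_cst.
by apply: filterS h => N ->.
Qed.

Context (v : int -> C) (l : C) (B : R).
Hypothesis vb : lp +oo%E v.
Hypothesis B0 : 0 <= B.
Hypothesis sol : forall N (f : int -> C), exists x : int -> C,
  (forall m, (absz m <= N)%N ->
     x (m - 1) + x (m + 1) + v m * x m - l * x m = f m) /\
  (forall M, vnorm (wcol M x) <= B * vnorm (wcol N f)).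

Lemma resolvent_solution (f : ell2 R) : exists x : ell2 R,
  schrodinger v x - l *: x = f /\ `|x| <= B%:C%C * `|f|.
Proof.
have /choice[X XP] := fun N => sol N f.
pose K := B * fine (lpnorm 2%:E f).
have K0 : 0 <= K by rewrite mulr_ge0 // fine_ge0 ?lpnorm_ge0.
have XK N M : vnorm (wcol M (X N)) <= K.
  by apply: le_trans ((XP N).2 M) _; apply: ler_wpM2l => //; apply: vnorm_wcol_le; exact: ell2P.
have [U [UU Uoo]] := ultraFilterLemma eventually_filter.
have [x Xx] := ultrafilter_ccvg UU (fun N m => le_trans (modulus_le_vnorm (X N) m) (XK N _)).
have xK M : vnorm (wcol M x) <= K by exact: vnorm_ccvg Xx _.
have x2 : x \in @ell2_pred R.
  by apply/ell2_predP; apply: le_lt_trans (lpnorm2_le K0 xK) _; rewrite ltry.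
exists (Ell2 x2); split.
  apply/val_inj/funext => m.
  rewrite -[LHS]/(schrodinger v (Ell2 x2) m - l * x m) schrodingerE //=.
  rewrite -addrA -mulrBl; apply: (ccvg_three_term _ (Xx (m - 1)) (Xx (m + 1)) (Xx m)).
  apply: Uoo; have : \forall N \near \oo, (absz m <= N)%N by exact: nbhs_infty_ge.
  by apply: filterS => N /((XP N).1) <-; ring.
rewrite -[leLHS]/(ell2norm _) -[X in _ * X]/(ell2norm _) /ell2norm -rmorphM lecR.
rewrite -lee_fin fineK ?ell2norm_fin //; exact: lpnorm2_le.
Qed.

(* The Wronskian of [x] with the solution [y] for the basis vector [n] equals
   [x n] on every large window, and it tends to [0]. *)
Lemma resolvent_unique (x : ell2 R) : schrodinger v x - l *: x = 0 -> x = 0.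
Proof.
move=> xE; apply/val_inj/funext => n.
have [y [yE _]] := resolvent_solution (Defs.basis R n).
have xm m : x (m - 1) + x (m + 1) + v m * x m - l * x m = 0.
  have : (schrodinger v x - l *: x) m = (0 : ell2 R) m by rewrite xE.
  by rewrite -[X in X = _ -> _]/(schrodinger v x m - l * x m) schrodingerE.
have ym m : y (m - 1) + y (m + 1) + v m * y m - l * y m = (m == n)%:R.
  have : (schrodinger v y - l *: y) m = Defs.basis R n m by rewrite yE.
  by rewrite -[X in X = _ -> _]/(schrodinger v y m - l * y m) schrodingerE.
pose w M := x M%:Z * y (M.+1%:Z) - y M%:Z * x (M.+1%:Z) +
  (x (- M%:Z) * y (- M.+1%:Z) - y (- M%:Z) * x (- M.+1%:Z)).
have wE M : wsum (fun m => x m * (m == n)%:R) M = w M.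
  (* Cross-multiplying the two equations cancels [v] and [l]; what is left telescopes over
     windows. *)
  have F m : x m * (m == n)%:R = x m * (y (m - 1) + y (m + 1)) - y m * (x (m - 1) + x (m + 1)).
    rewrite -ym -[RHS]addr0 -(mulr0 (y m)) -(xm m); ring.
  elim: M => [|M IH].
    by rewrite wsum0 F /w oppr0 !add0r; ring.
  rewrite wsumS IH !F /w.
  have -> : M.+1%:Z + 1 = M.+2%:Z by lia.
  have -> : M.+1%:Z - 1 = M%:Z by lia.
  have -> : - M.+1%:Z - 1 = - M.+2%:Z by lia.
  have -> : - M.+1%:Z + 1 = - M%:Z by lia.
  by ring.
have [x1 x2] := lp2_vanish (ell2P x); have [y1 y2] := lp2_vanish (ell2P y).
have xs := x1; have xs2 := x2; have ys := y1; have ys2 := y2.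
rewrite -(cvg_shiftn 1) in xs; rewrite -(cvg_shiftn 1) in xs2.
rewrite -(cvg_shiftn 1) in ys; rewrite -(cvg_shiftn 1) in ys2.
have lim : modulus (x M%:Z) * modulus (y (M + 1)%:Z) +
    modulus (y M%:Z) * modulus (x (M + 1)%:Z) +
    (modulus (x (- M%:Z)) * modulus (y (- (M + 1)%:Z)) +
     modulus (y (- M%:Z)) * modulus (x (- (M + 1)%:Z))) @[M --> \oo] --> (0 : R).
  have -> : (0 : R) = 0 * 0 + 0 * 0 + (0 * 0 + 0 * 0) by rewrite !mulr0 !addr0.
  by apply: cvgD; apply: cvgD; apply: cvgM.
apply: modulus_eq0; apply/le_anti; rewrite modulus_ge0 andbT.
apply: ler_cvg_to (cvg_cst (modulus (x n))) lim _.
have : \forall M \near \oo, (absz n <= M)%N by exact: nbhs_infty_ge.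
apply: filterS => M nM; have [i iE] := idx_surj nM.
have -> : x n = w M.
  rewrite -wE /wsum (bigD1 i) //= iE eqxx mulr1 big1 ?addr0 // => j ji.
  by rewrite -iE (inj_eq (@idx_inj M)) (negbTE ji) mulr0.
rewrite /w addn1; apply: le_trans (modulusD _ _) _; apply: lerD;
  by apply: le_trans (modulusD _ _) _; rewrite modulusN !modulusM.
Qed.

End pointwise_limit.

(** * The resolvent set *)

Section resolvent.
Context (R : realType).
Local Notation C := R[i].

(** Injectivity makes the chosen right inverse linear and two-sided, and the norm estimate makes it
    continuous. *)
Lemma mem_resolvent_set (v : int -> C) (l : C) (B : R) :
  lp +oo%E v ->
  (forall f : ell2 R, exists x : ell2 R,
     schrodinger v x - l *: x = f /\ `|x| <= B%:C%C * `|f|) ->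
  (forall x : ell2 R, schrodinger v x - l *: x = 0 -> x = 0) ->
  resolvent_set (schrodinger v) l.
Proof.
move=> vb ex uniq; pose T (x : ell2 R) := schrodinger v x - l *: x.
have Tlin a x y : T (a *: x + y) = a *: T x + T y.
  rewrite /T (schrodinger_linear vb) [l *: (_ + _)]scalerDr [a *: (_ - _)]scalerBr !scalerA.
  by rewrite [l * a]mulrC opprD addrACA.
have Tinj x y : T x = T y -> x = y.
  move=> xy; apply/eqP; rewrite -subr_eq0; apply/eqP/uniq.
  rewrite -/(T _) -[x - y]addrC -scaleN1r Tlin xy scaleN1r.
  exact: addNr.
have /choice[S SP] := ex.
have TS f : T (S f) = f by exact: (SP f).1.
have Slin : linear S by move=> a f g; apply: Tinj; rewrite Tlin !TS.
pose SL := GRing.isLinear.Build _ _ _ _ _ Slin.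
pose S' : {linear ell2 R -> ell2 R} := HB.pack S SL.
exists S'; split=> [|x|f].
- apply: bounded_linear_continuous; apply/linear_boundedP.
  exists B%:C%C; split; first by rewrite complex_real.
  by move=> r Br f; apply: le_trans (SP f).2 _; rewrite ler_wpM2r // ltW.
- by rewrite -[LHS]/(S (T x)); exact: Tinj (TS (T x)).
- exact: (TS f).
Qed.

Lemma dist_segment_le (l : C) (s : R) : -2 <= s <= 2 ->
  dist l (@segment R) <= modulus (l - s%:C%C).
Proof.
move=> s2; apply: ge_inf; first by exists 0 => _ [a _ <-]; exact: modulus_ge0.
by exists s%:C%C => //; exists s.
Qed.

Lemma dist_ge0 (l : C) : 0 <= dist l (@segment R).
Proof.
apply: lb_le_inf; last by move=> _ [a _ <-]; exact: modulus_ge0.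
by exists (modulus (l - 0%:C%C)), 0%:C%C => //; exists 0 => //=; rewrite in_itv /=; lra.
Qed.

(** The roots [a] and [b] of z^2 - l z + 1 have product 1, so one lies inside the unit circle unless
    both lie on it. In that case [b] is the conjugate of [a] and l = 2 Re a belongs to the
    segment. *)
Lemma joukowsky (l : C) : 0 < dist l (@segment R) ->
  exists k : C, [/\ 0 < modulus k, modulus k < 1 & l = k + k^-1].
Proof.
move=> dpos; pose s := sqrtc (l ^+ 2 / 4 - 1).
pose a := l / 2 + s; pose b := l / 2 - s.
have s2 : s ^+ 2 = l ^+ 2 / 4 - 1 by exact: sqr_sqrtc.
have ab : a * b = 1.
  by rewrite /a /b mulrC -subr_sqr s2; field.
have sab : a + b = l by rewrite /a /b; field.
have mab : modulus a * modulus b = 1 by rewrite -modulusM ab modulus1.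
have a0 : 0 < modulus a by have := modulus_ge0 a; have := modulus_ge0 b; nra.
have b0 : 0 < modulus b by have := modulus_ge0 a; have := modulus_ge0 b; nra.
have inv (x y : C) : x * y = 1 -> x^-1 = y.
  move=> xy; have x0 : x != 0 by apply: contra_eq_neq xy => ->; rewrite mul0r eq_sym oner_eq0.
  by apply: (mulfI x0); rewrite mulfV.
have [a1|a1|a1] := ltgtP (modulus a) 1.
- by exists a; split=> //; rewrite (inv _ _ ab).
- exists b; split=> //; last by rewrite (inv b a) 1?mulrC // addrC.
  by move: mab a1 b0; nra.
have aJ : b = conjc a.
  have : a * conjc a = 1 by rewrite -sqr_normc modulusE a1 expr1n.
  by move=> /inv <-; rewrite (inv _ _ ab).
have : -2 <= 2 * complex.Re a <= 2.
  have := normRe_le_modulus a; rewrite a1 ler_norml; lra.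
move=> /(dist_segment_le l).
have lE : l = (2 * complex.Re a)%:C%C by rewrite -sab aJ addcJ rmorphM rmorph_nat.
by move: dpos; rewrite lE subrr modulus0 ltNge => /negbTE ->.
Qed.

(** Both cases of the theorem end here: each has to supply one bound [q < 1] valid on all windows at
    once. *)
Lemma resolvent_criterion (v : int -> C) (l k : C) (d q : R) :
  lp +oo%E v -> 0 < modulus k -> modulus k < 1 -> l = k + k^-1 ->
  0 < d -> d <= dist l (@segment R) -> 0 <= q -> q < 1 ->
  (forall N, let W := wmx (fun i : 'I_N.*2.+1 => wgt v (idx i)) in
     opb (W *m greenmx k N *m W) q) ->
  resolvent_set (schrodinger v) l.
Proof.
move=> vb k0 k1 lk d0 dd q0 q1 hq.
have hd s : -2 <= s <= 2 -> d <= modulus (k + k^-1 - s%:C%C).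
  by move=> s2; apply: le_trans dd _; rewrite -lk; exact: dist_segment_le.
pose c := Num.sqrt (fine (lpnorm +oo%E v)).
have wc m : wgt v m <= c.
  apply: ler_wsqrtr; rewrite -lee_fin fineK; last by rewrite ge0_fin_numE ?lpnorm_ge0.
  exact: (lpnormy_leP v _).1 (lexx _) m.
have c0 : 0 <= c by exact: sqrtr_ge0.
have B0 := solbound_ge0 d0 q1 c0.
have sol N f := window_solution k0 k1 d0 hd q0 q1 c0 wc hq N f.
rewrite -lk in sol; apply: (mem_resolvent_set (B := solbound d q c)) => //.
  exact: resolvent_solution.
exact: resolvent_unique vb B0 sol.
Qed.

End resolvent.

Theorem theorem3 (R : realType) (p : \bar R) (v : int -> R[i])
    (hp : (1 < p)%E) (hv : lp p v) :
  spectrum (schrodinger v) `<=`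
  [set l : R[i] |
    if p is r%:E then
      modulus (l ^+ 2 - 4) * dist l (@segment R) `^ (2 * r - 2)
        <= fine (lpnorm p v) `^ (2 * r)
    else dist l (@segment R) <= fine (lpnorm p v)].
Proof.
have vb : lp +oo%E v by apply: lp_bounded hv; exact: ltW.
move=> l lspec /=; case: p hp hv => [r|_ hv|//]; last first.
  (* Case [p = +oo]: no interpolation, since ||W||^2 times the norm of the Green matrix is at most
     [L / d]. *)
  rewrite leNgt; apply/negP => ltd; apply: lspec.
  set d := dist l _ in ltd; set L := fine _ in ltd.
  have L0 : 0 <= L by rewrite fine_ge0 ?lpnorm_ge0.
  have d0 : 0 < d by exact: le_lt_trans ltd.
  have [k [k0 k1 lk]] := joukowsky d0.
  have hd s : -2 <= s <= 2 -> d <= modulus (k + k^-1 - s%:C%C).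
    by rewrite -lk; exact: dist_segment_le.
  apply: (resolvent_criterion (q := L / d) vb k0 k1 lk d0) => //.
  - by rewrite divr_ge0 // ltW.
  - by rewrite ltr_pdivrMr // mul1r.
  move=> N W.
  have hW : opb W (Num.sqrt L).
    apply: opb_wmx => [i|]; last exact: sqrtr_ge0.
    rewrite wgt_ge0 ler_wsqrtr // -lee_fin fineK.
      exact: (lpnormy_leP v _).1 (lexx _) _.
    by rewrite ge0_fin_numE ?lpnorm_ge0.
  have -> : L / d = Num.sqrt L * d^-1 * Num.sqrt L.
    by rewrite mulrAC -expr2 sqr_sqrtr.
  have d1 : 0 <= d^-1 by rewrite invr_ge0 ltW.
  have hA : opb (greenmx k N) d^-1 by exact: opb_greenmx.
  have sL : 0 <= Num.sqrt L by exact: sqrtr_ge0.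
  exact: opbM (mulr_ge0 sL d1) (opbM sL hW hA) hW.
rewrite lte_fin => r1 hv; rewrite leNgt; apply/negP => ltX; apply: lspec.
set d := dist l _ in ltX; set L := fine _ in ltX.
have L0 : 0 <= L by rewrite fine_ge0 ?lpnorm_ge0.
have r0 : 0 < r by exact: lt_trans r1.
(* At d = 0 the factor with exponent [2 * r - 2] would vanish because [1 < r]; for r = 1 it would be
   0^0 = 1. *)
have d0 : 0 < d.
  rewrite lt_def dist_ge0 andbT; apply: contraTneq ltX => ->.
  by rewrite powR0 ?mulr0 -?leNgt ?powR_ge0 //; apply/eqP; lra.
have [k [k0 k1 lk]] := joukowsky d0.
have hd s : -2 <= s <= 2 -> d <= modulus (k + k^-1 - s%:C%C).
  by rewrite -lk; exact: dist_segment_le.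
set G := modulus (k - k^-1); have G0 : 0 < G by exact: kVk_gt0.
(* [Y] is the square root of the left-hand side, as (k - k^-1)^2 = l^2 - 4 for l = k + k^-1. *)
pose Y := G * d `^ (r - 1).
have LY : L `^ r < Y.
  have Y0 : 0 <= Y by rewrite mulr_ge0 ?powR_ge0 // ltW.
  rewrite -ltr_sqr ?nnegrE ?powR_ge0 //.
  have pow2 (x t : R) : (x `^ t) ^+ 2 = x `^ (2 * t).
    by rewrite mulrC powRrM powR_mulrn ?powR_ge0.
  rewrite /Y exprMn !pow2 [2 * (r - 1)](_ : _ = 2 * r - 2); last by ring.
  suff -> : G ^+ 2 = modulus (l ^+ 2 - 4) by [].
  rewrite /G expr2 -modulusM lk; congr modulus.
  by field; exact: k_neq0.
(* [L] is 0 for [v = 0], while [opb_weighted] needs a positive constant; the midpoint with [Y] is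
   positive and still below [Y]. *)
have [S [S0 LS SY]] : exists S, [/\ 0 < S, L `^ r <= S & S < Y].
  exists ((L `^ r + Y) / 2); move: LY (powR_ge0 L r).
  by move: (L `^ r) Y => x y xy x0; split; lra.
pose q := d^-1 `^ (1 - r^-1) * (G^-1 * S) `^ r^-1.
apply: (resolvent_criterion (q := q) vb k0 k1 lk d0) => //.
- by rewrite mulr_ge0 ?powR_ge0.
(* The number 1 is the expression [q] with [S] replaced by [Y], so [S < Y] yields [q < 1]. *)
- have -> : 1 = d^-1 `^ (1 - r^-1) * (d `^ (r - 1)) `^ r^-1.
    rewrite -powRrM mulrBl mul1r mulfV ?gt_eqF // -powRM ?invr_ge0 ?(ltW d0) //.
    by rewrite mulVf ?gt_eqF // powR1.
  rewrite ltr_pM2l ?powR_gt0 ?invr_gt0 //.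
  apply: gt0_ltr_powR; rewrite ?invr_gt0 ?nnegrE ?powR_ge0 //.
    by rewrite mulr_ge0 ?invr_ge0 // ltW.
  by rewrite mulrC ltr_pdivrMr // mulrC.
move=> N W; apply: opb_weighted => //; first exact: ltW.
- by rewrite invr_gt0.
- by rewrite invr_gt0.
- by move=> i j; rewrite mxE; exact: green_le.
- exact: opb_greenmx.
- by move=> i; exact: wgt_ge0.
apply: le_trans LS; apply: le_trans (wsum_powR_le N r0 hv).
apply: ler_sum => i _; rewrite powRrM powR_mulrn ?wgt_ge0 //.
by rewrite sqr_wgt.
Qed.
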